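(* Let $d,k$ be integers with $1\leq k\leq d-1$, and let $E\subset\mathbb{R}^d$ be a Borel set with $\dim_{\mathrm H}(E)>s>k$. Suppose that the following two conditions hold. (1) The incidence set $$\mathcal{S}:=\{(\psi_k(\boldsymbol{x}),\boldsymbol{x}):\boldsymbol{x}\in E^{k+1}\setminus D\}\subset\mathcal{A}(d,k)\times\mathbb{R}^{(k+1)d}$$ has the Fubini property. (2) With $\beta=\dim_{\mathrm H}(\mathcal{P}^k(E))$, $$\operatorname{ess-sup}^{\beta}_{W^{k+1}\in\mathcal{W}^{k+1}(E)}\dim_{\mathrm H}(E^{k+1}\cap W^{k+1})\leq\max\{0,\dim_{\mathrm H}(E^{k+1})-(k+1)(d-k)\}.$$ Then $$\dim_{\mathrm H}\mathcal{P}^k(E)\geq(k+1)\min\{s,d-k\}.$$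
   Context: $\dim_{\mathrm H}$ is Hausdorff dimension and $\mathcal{H}^t$ is $t$-dimensional Hausdorff (outer) measure. Affine Grassmannian: $\mathcal{A}(d,k)$ is the set of $k$-dimensional affine subspaces of $\mathbb{R}^d$. Writing $W=W_0+p$ with $W_0$ a $k$-dimensional linear subspace and $p\in W_0^\perp$, it is given its natural metric $\|P_{W_0}-P_{V_0}\|+|p-q|$ for $W=W_0+p$, $V=V_0+q$, where $P_{W_0}$ is the orthogonal projection matrix onto $W_0$. Via $W\mapsto(P_{W_0},p)$ it is regarded as a subset of a Euclidean space $\mathbb{R}^{d^2+d}$. Spans: $D\subset E^{k+1}$ is the set of tuples $(x_0,\ldots,x_k)\in E^{k+1}$ that are affinely dependent, and for $\boldsymbol{x}=(x_0,\ldots,x_k)\in E^{k+1}\setminus D$, $\psi_k(\boldsymbol{x}):=\operatorname{aff}\{x_0,\ldots,x_k\}\in\mathcal{A}(d,k)$ is the affine span. $\mathcal{P}^k(E):=\psi_k(E^{k+1}\setminus D)$ is the set of $k$-planes spanned by $k+1$ affinely independent points of $E$. For $W\in\mathcal{P}^k(E)$, $W^{k+1}=W\times\cdots\times W\subset\mathbb{R}^{d(k+1)}$, and $\mathcal{W}^{k+1}(E):=\{W^{k+1}:W\in\mathcal{P}^k(E)\}\subset\mathcal{A}(d(k+1),k(k+1))$; $\dim_{\mathrm H}\mathcal{W}^{k+1}(E)=\dim_{\mathrm H}\mathcal{P}^k(E)=\beta$. Essential supremum: for a nonempty set $Z$ in a metric space with $\alpha=\dim_{\mathrm H}(Z)$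 and $f:Z\to[0,\infty)$: if $\mathcal{H}^\alpha(Z)>0$, then $$\operatorname{ess-sup}^{\alpha}_{z\in Z}f(z):=\sup\{q\geq 0:\mathcal{H}^{\alpha}(\{z\in Z:f(z)>q\})>0\},$$ with $\sup\emptyset=0$; if $\mathcal{H}^\alpha(Z)=0$, then $$\operatorname{ess-sup}^{\alpha}_{z\in Z}f(z):=\lim_{\varepsilon\to0+}\sup\{q\geq 0:\mathcal{H}^{\alpha-\varepsilon}(\{z\in Z:f(z)>q\})>0\}.$$ Fubini property: a nonempty set $B\subset\mathbb{R}^m\times\mathbb{R}^n$, with $\pi_X$ the orthogonal projection onto the first factor $\mathbb{R}^m$, has the Fubini property if $$\dim_{\mathrm H}(B)=\dim_{\mathrm H}(\pi_X(B))+\operatorname{ess-sup}^{\alpha}_{x\in\pi_X(B)}\dim_{\mathrm H}(\pi_X^{-1}(x)\cap B),\qquad\alpha=\dim_{\mathrm H}(\pi_X(B)).$$ For $\mathcal{S}$, the first factor is (the Euclidean space containing) $\mathcal{A}(d,k)$ and the second factor is $\mathbb{R}^{(k+1)d}$. *)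

(* Defs.v *)
From mathcomp Require Import all_boot all_order all_algebra.
From mathcomp Require Import all_classical all_reals all_analysis.

Import Order.TTheory GRing.Theory Num.Theory.
Import numFieldNormedType.Exports.

Local Open Scope classical_set_scope.
Local Open Scope ring_scope.

(* The distance is an explicit argument: the norm topology carried by matrices
   in MathComp-Analysis comes from the sup norm, whereas Euclidean spaces and
   affine Grassmannians are used here with their own metrics. A cover of A may
   be replaced by its trace on A, so hmeasure dist t A only depends on dist
   restricted to A. *)
Section Hausdorff.
Context {R : realType} {T : Type}.
Variable dist : T -> T -> R.
Local Open Scope ereal_scope.

Definition diam (U : set T) : \bar R :=
  ereal_sup [set z | exists x y, [/\ U x, U y & z = (dist x y)%:E]].

(* The term (diam U)^t of a Hausdorff sum. The empty set always contributes 0;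
   as 0 `^ 0 = 1, a nonempty set contributes 1 when t = 0, so that
   hmeasure 0 is the counting measure. *)
Definition hgauge (t : R) (U : set T) : \bar R :=
  if `[< U = set0 >] then 0 else diam U `^ t.

Definition delta_cover (delta : R) (A : set T) : set (nat -> set T) :=
  [set U | A `<=` \bigcup_i U i /\ forall i, diam (U i) <= delta%:E].

Definition hcontent (delta t : R) (A : set T) : \bar R :=
  ereal_inf [set \sum_(i <oo) hgauge t (U i) | U in delta_cover delta A].

Definition hmeasure (t : R) (A : set T) : \bar R :=
  ereal_sup [set hcontent delta t A | delta in [set delta : R | (0 < delta)%R]].

Definition hdim (A : set T) : \bar R :=
  ereal_inf [set t%:E | t in [set t : R | (0 <= t)%R /\ hmeasure t A = 0]].

(* sup {q >= 0 : H^t {z in Z : f z > q} > 0}; adjoining 0 only implements the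
   convention sup set0 = 0. *)
Definition hsup (t : R) (Z : set T) (f : T -> \bar R) : \bar R :=
  ereal_sup (0 |` [set q%:E | q in
    [set q : R | (0 <= q)%R /\ 0 < hmeasure t [set z | Z z /\ q%:E < f z]]]).

(* Used with alpha = dim_H Z. *)
Definition hess_sup (alpha : R) (Z : set T) (f : T -> \bar R) : \bar R :=
  if 0 < hmeasure alpha Z then hsup alpha Z f
  else lim (hsup (alpha - e)%R Z f @[e --> (0%R : R)^'+]).

End Hausdorff.

Section Euclidean.
Context {R : realType}.

Definition enorm {n} (v : 'rV[R]_n) : R := Num.sqrt (\sum_i v 0 i ^+ 2).

Definition eucl_dist {n} (u v : 'rV[R]_n) : R := enorm (u - v).

(* The operator norm, for matrices acting on row vectors. *)
Definition opnorm {n} (M : 'M[R]_n) : R :=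
  sup [set enorm (v *m M) | v in [set v : 'rV[R]_n | enorm v <= 1]].

(* The open sets are those of the sup norm, hence those of eucl_dist. *)
Definition borel n : set (set 'rV[R]_n) := <<s open >>.

(* A point of R^(mn) is read as an m-tuple of points of R^n, the rows of
   vec_mx w. *)
Definition tuple_pow m {n} (A : set 'rV[R]_n) : set 'rV[R]_(m * n) :=
  [set w | forall i : 'I_m, A (row i (vec_mx w))].

(* X |-> X *m orthoproj U is the orthogonal projection onto the row space of U:
   the rows of kermx U^T span the vectors orthogonal to all rows of U. *)
Definition orthoproj {n} (U : 'M[R]_n) : 'M[R]_n :=
  proj_mx <<U>>%MS (kermx U^T).

End Euclidean.

Section Flats.
Context {R : realType}.

(* U + p, where U stands for the linear subspace spanned by its rows. *)
Definition flat {n} (U : 'M[R]_n) (p : 'rV[R]_n) : set 'rV[R]_n :=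
  [set x | (x - p <= U)%MS].

Definition affine_Gr n k : set (set 'rV[R]_n) :=
  [set W | exists U p, \rank U = k /\ W = flat U p].

(* W = U + p with p orthogonal to U. *)
Definition is_normal_form {n} (W : set 'rV[R]_n)
    (c : 'M[R]_n * 'rV[R]_n) : Prop :=
  c.2 *m c.1^T = 0 /\ W = flat c.1 c.2.

Definition normal_form {n} (W : set 'rV[R]_n) : 'M[R]_n * 'rV[R]_n :=
  xget (0, 0) [set c | is_normal_form W c].

Definition dirproj {n} (W : set 'rV[R]_n) : 'M[R]_n :=
  orthoproj (normal_form W).1.

Definition offset {n} (W : set 'rV[R]_n) : 'rV[R]_n := (normal_form W).2.

Definition Gr_dist {n} (W V : set 'rV[R]_n) : R :=
  opnorm (dirproj W - dirproj V) + enorm (offset W - offset V).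

Definition Gr_coord {n} (W : set 'rV[R]_n) : 'rV[R]_(n * n + n) :=
  row_mx (mxvec (dirproj W)) (offset W).

Definition affinely_dependent {m n} (x : 'rV[R]_(m * n)) : Prop :=
  exists l : 'rV[R]_m, [/\ l != 0, \sum_i l 0 i = 0 & l *m vec_mx x = 0].

Definition affine_span {m n} (x : 'rV[R]_(m * n)) : set 'rV[R]_n :=
  [set l *m vec_mx x | l in [set l : 'rV[R]_m | \sum_i l 0 i = 1]].

(* E^{k+1} \ D *)
Definition indep_tuples {d} k (E : set 'rV[R]_d) : set 'rV[R]_(k.+1 * d) :=
  [set x | tuple_pow k.+1 E x /\ ~ affinely_dependent x].

(* P^k(E) *)
Definition spanned_planes {d} k (E : set 'rV[R]_d) : set (set 'rV[R]_d) :=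
  affine_span @` indep_tuples k E.

(* W^{k+1}(E) *)
Definition spanned_powers {d} k (E : set 'rV[R]_d) :
    set (set 'rV[R]_(k.+1 * d)) :=
  tuple_pow k.+1 @` spanned_planes k E.

Definition incidence {d} k (E : set 'rV[R]_d) :
    set 'rV[R]_((d * d + d) + k.+1 * d) :=
  [set row_mx (Gr_coord (affine_span x)) x | x in indep_tuples k E].

End Flats.

(* lsubmx is the orthogonal projection of R^m x R^n onto R^m. *)
Definition Fubini_property {R : realType} {m n} (B : set 'rV[R]_(m + n)) : Prop :=
  let X : set 'rV[R]_m := lsubmx @` B in
  B !=set0 /\
  hdim eucl_dist B =
    (hdim eucl_dist X +
     hess_sup eucl_dist (fine (hdim eucl_dist X)) X
       (fun x => hdim eucl_dist (B `&` lsubmx @^-1` [set x])))%E.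

(* On affine_Gr n k the choice made by normal_form is harmless: a normal form
   exists, and the orthogonal projection and the offset do not depend on it. *)
Section Grassmannian_wellposed.
Context {R : realType}.
Set Implicit Arguments.

Lemma mulmx_tr_eq0 n (v : 'rV[R]_n) : v *m v^T = 0 -> v = 0.
Proof.
move=> /matrixP /(_ 0 0); rewrite !mxE => s0.
apply/rowP => j; rewrite mxE; apply/eqP; rewrite -sqrf_eq0 expr2; apply/eqP.
have s0' : \sum_j v 0 j * v 0 j = 0 by rewrite -[RHS]s0; apply: eq_bigr => i _; rewrite mxE.
by apply: (psumr_eq0P _ s0') => // i _; rewrite -expr2 sqr_ge0.
Qed.

Lemma cap_ortho n (U : 'M[R]_n) : (<<U>> :&: kermx U^T = 0)%MS.
Proof.
apply/eqP; rewrite -submx0; apply/rV_subP => v.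
rewrite sub_capmx genmxE => /andP[/submxP[a ->] /sub_kermxP h].
have -> : a *m U = 0.
  by apply: mulmx_tr_eq0; rewrite trmx_mul mulmxA h mul0mx.
exact: sub0mx.
Qed.

Lemma add_ortho n (U : 'M[R]_n) : (1%:M <= <<U>> + kermx U^T)%MS.
Proof.
rewrite sub1mx /row_full; apply/eqP.
have := mxrank_sum_cap <<U>>%MS (kermx U^T).
rewrite cap_ortho mxrank0 addn0 => ->.
by rewrite mxrank_ker mxrank_tr genmxE subnKC // rank_leq_row.
Qed.

Lemma orthoproj_id n (U : 'M[R]_n) (v : 'rV[R]_n) :
  (v <= U)%MS -> v *m orthoproj U = v.
Proof. by move=> vU; apply: proj_mx_id; rewrite ?cap_ortho ?genmxE. Qed.

Lemma orthoproj_0 n (U : 'M[R]_n) (v : 'rV[R]_n) :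
  v *m U^T = 0 -> v *m orthoproj U = 0.
Proof. by move=> vU; apply: proj_mx_0; rewrite ?cap_ortho //; apply/sub_kermxP. Qed.

Lemma orthoproj_sub n (U : 'M[R]_n) (v : 'rV[R]_n) : (v *m orthoproj U <= U)%MS.
Proof. by rewrite (submx_trans (proj_mx_sub _ _ _)) // genmxE. Qed.

Lemma orthoproj_compl n (U : 'M[R]_n) (v : 'rV[R]_n) : (v - v *m orthoproj U) *m U^T = 0.
Proof.
apply/sub_kermxP; apply: proj_mx_compl_sub.
by rewrite (submx_trans (submx1 _)) // add_ortho.
Qed.

Lemma flat_mem n (U : 'M[R]_n) p : flat U p p.
Proof. by rewrite /flat /= subrr sub0mx. Qed.

Lemma flat_subE n (U V : 'M[R]_n) p q : flat U p = flat V q -> (U <= V)%MS.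
Proof.
move=> e; apply/rV_subP => v vU.
have : flat V q (v + p) by rewrite -e /flat /= addrK.
have : flat V q p by rewrite -e; exact: flat_mem.
rewrite /flat /= => h1 h2.
have -> : v = (v + p - q) - (p - q) by rewrite opprB addrA subrK addrK.
by rewrite addmx_sub // eqmx_opp.
Qed.

Lemma normal_form_uniq n (W : set 'rV[R]_n) U p V q :
  is_normal_form W (U, p) -> is_normal_form W (V, q) ->
  orthoproj U = orthoproj V /\ p = q.
Proof.
move=> [/= pU eU] [/= qV eV]; rewrite eU in eV.
have UV := flat_subE eV; have VU := flat_subE (esym eV).
have orthUV (v : 'rV[R]_n) : v *m U^T = 0 <-> v *m V^T = 0.
  split; [case/submxP: VU => D -> | case/submxP: UV => D ->];
  by rewrite trmx_mul mulmxA => ->; rewrite mul0mx.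
split.
  apply/row_matrixP => i; rewrite !rowE; set v := delta_mx _ _.
  rewrite -[in LHS](subrK (v *m orthoproj V) v) mulmxDl orthoproj_0 ?add0r.
    by rewrite orthoproj_id // (submx_trans (orthoproj_sub _ _)).
  by apply/orthUV; rewrite orthoproj_compl.
apply/eqP; rewrite -subr_eq0; apply/eqP; apply: mulmx_tr_eq0.
have : flat V q p by rewrite -eV; exact: flat_mem.
rewrite /flat /= => /submxP[D hD]; rewrite [in X in _ *m X]hD trmx_mul mulmxA.
have h : (p - q) *m V^T = 0 by rewrite mulmxBl qV (proj1 (orthUV p) pU) subrr.
by rewrite h mul0mx.
Qed.

Lemma normal_formP n k (W : set 'rV[R]_n) : affine_Gr n k W ->
  is_normal_form W (normal_form W).
Proof.
move=> [U [p [_ ->]]]; rewrite /normal_form; case: xgetP => [c -> //|].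
move=> /(_ (U, p - p *m orthoproj U)) []; split => /=; first exact: orthoproj_compl.
apply/seteqP; split => x; rewrite /flat /= => h.
  have -> : x - (p - p *m orthoproj U) = (x - p) + p *m orthoproj U by rewrite opprB addrA addrAC.
  by rewrite addmx_sub ?orthoproj_sub.
have -> : x - p = (x - (p - p *m orthoproj U)) - p *m orthoproj U.
  by rewrite opprB addrA addrAC addrK.
by rewrite addmx_sub // eqmx_opp orthoproj_sub.
Qed.

Lemma orthoproj_sym n (U : 'M[R]_n) : (orthoproj U)^T = orthoproj U.
Proof.
set P := orthoproj U.
have key (u v : 'rV[R]_n) : u *m P *m (v - v *m P)^T = 0.
  have /submxP[D ->] := orthoproj_sub U u.
  by apply: trmx_inj; rewrite trmx_mul trmxK trmx_mul mulmxA orthoproj_compl mul0mx trmx0.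
have PP : P *m P^T = P.
  apply/row_matrixP => i; apply: trmx_inj; apply/row_matrixP => j.
  rewrite !rowE; have := key (delta_mx 0 i) (delta_mx 0 j).
  rewrite linearB /= mulmxBr => /eqP; rewrite subr_eq0 => /eqP /(congr1 trmx).
  by rewrite !trmx_mul !trmxK !mulmxA => ->.
by rewrite -[in LHS]PP trmx_mul trmxK.
Qed.

Lemma affine_span_Gr k n (x : 'rV[R]_(k.+1 * n)) :
  ~ affinely_dependent x -> affine_Gr n k (affine_span x).
Proof.
move=> ind; pose X := vec_mx x : 'M[R]_(1 + k, n); pose p := row 0 X.
pose A : 'M[R]_(k, n) := \matrix_i (row (rshift 1 i) X - p).
have comb (c : R) (v : 'rV[R]_k) :
    (row_mx (c - \sum_i v 0 i)%:M v : 'rV[R]_(1 + k)) *m X = v *m A + c *: p.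
  rewrite -[X]vsubmxK mul_row_col.
  have -> : usubmx X = p.
    apply/rowP => j; rewrite [LHS]mxE [RHS]mxE; congr (fun_of_matrix X _ j); exact: val_inj.
  have -> : A = dsubmx X - \matrix_(i < k) p.
    apply/row_matrixP => i; rewrite rowK linearB /= rowK; congr (_ - _).
    by apply/rowP => j; rewrite !mxE.
  rewrite mulmxBr (_ : v *m (\matrix_i p) = (\sum_i v 0 i) *: p); last first.
    by rewrite mulmx_sum_row scaler_suml; apply: eq_bigr => i _; rewrite rowK.
  by rewrite mul_scalar_mx scalerBl addrC addrAC addrA.
have sumc (c : R) (v : 'rV[R]_k) :
    \sum_i (row_mx (c - \sum_i v 0 i)%:M v : 'rV[R]_(1 + k)) 0%R i = c.
  rewrite big_split_ord /= big_ord1 row_mxEl mxE eqxx mulr1n.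
  by under [X in _ + X]eq_bigr do rewrite row_mxEr; rewrite subrK.
exists <<A>>%MS, p; split.
  rewrite genmxE; apply/eqP; rewrite -/(row_free A); apply/negPn/negP => nf.
  apply: ind.
  have : kermx A != 0 by rewrite kermx_eq0.
  case/rowV0Pn => v /sub_kermxP vA v0.
  exists (row_mx (0 - \sum_i v 0 i)%:M v : 'rV[R]_(1 + k)); split.
  - apply: contra_neq v0 => e; rewrite -[v](row_mxKr (0 - \sum_i v 0 i)%:M) e.
    by apply/rowP => j; rewrite !mxE.
  - exact: sumc.
  - by rewrite comb vA add0r scale0r.
apply/seteqP; split => y; rewrite /affine_span /flat /= genmxE.
  case=> l sl <-; set r := rsubmx (l : 'rV[R]_(1 + k)).
  have -> : l = row_mx (1 - \sum_i r 0%R i)%:M r :> 'rV[R]_(1 + k).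
    have h := hsubmxK (l : 'rV[R]_(1 + k)); rewrite -[LHS]h; congr row_mx.
    apply/rowP => j; rewrite (ord1 j) !mxE eqxx mulr1n -sl.
    rewrite (@big_split_ord _ _ _ 1 k) /= big_ord1.
    under [X in _ - X]eq_bigr do rewrite mxE.
    by rewrite addrK.
  by rewrite comb scale1r addrK submxMl.
case/submxP => D e; exists (row_mx (1 - \sum_i D 0%R i)%:M D : 'rV[R]_(1 + k)); first exact: sumc.
by rewrite comb scale1r -e subrK.
Qed.

End Grassmannian_wellposed.

(* Main.v *)
Require Import Defs.
From mathcomp Require Import all_boot all_order all_algebra.
From mathcomp Require Import all_classical all_reals all_analysis.
From mathcomp Require Import measurable_realfun ring lra zify.

(** Write T for the dimension of the power E^(k+1), N for (k+1)(d-k), and P for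
    the set of planes spanned by E. The incidence set projects onto the set of
    independent tuples by a Lipschitz map, so its dimension is at least that of
    E^(k+1) minus D ([hdim_indep_tuples_le]). By the Fubini property it is also
    dim P plus the essential supremum of the dimensions of the fibres. The fibre
    over W lies in a copy of the part of E^(k+1) inside W^(k+1), so the
    assumed bound makes this supremum at most max(0, T-N)
    ([hess_sup_incidence]). Hence

      dim (E^(k+1) minus D) <= dim P + max(0, T - N),

    and the theorem follows from T <= dim (E^(k+1) minus D) and (k+1)s <= T.

    Both come from the product inequality dim A + dim B <= dim (A x B)
    ([null_product]). The second is an induction on k. For the first, a tuple of
    D has a coordinate that is a linear combination of the others, so that
    dim (D in E^(k+1)) <= dim E^k + k ([null_dependent], through
    [null_cube_bundle]), whereas dim E^k + s <= T and k < s: the tuples in D are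
    too few to matter ([null_indep_tuples]).

    The product inequality is proved for arbitrary sets, without Frostman
    measures. Let sets V_i of diameter at most r_i cover A x B with a small sum
    of r_i^(s+t), where B is not t-null. For each a in A, the V_i that meet
    {a} x B cover B, so the r_i^t with a in the projection U_i of V_i add up to
    at least a constant c. Thus the U_i, with weights r_i^t, cover A c times over
    at the small total cost of r_i^t r_i^s. Replacing the U_i by dyadic cubes,
    which are nested or disjoint, one extracts from such a weighted cover an
    honest cover of no larger cost, up to a constant ([weighted_thinning]).

    Everything depends on Hausdorff measures only through the sets that they do
    not charge, and null sets are carried along Lipschitz relations
    ([null_lipschitz]). This is what makes the passage between the metric on
    flats, the Euclidean coordinates of a flat and the metric on the powers
    W^(k+1) harmless: all three compare, up to constants, to the largest
    difference of entries of the projections and offsets. *)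

Set Implicit Arguments.
Unset Strict Implicit.
Unset Printing Implicit Defensive.

Import Order.TTheory GRing.Theory Num.Theory.
Import numFieldNormedType.Exports.

Local Open Scope classical_set_scope.
Local Open Scope ring_scope.

(** * Null sets for the Hausdorff measures *)

Section NullSets.
Context {R : realType}.

(** The radii [r i] stand for the diameters, which avoids extended reals and the
    separate treatment of empty sets: for [t != 0] an empty set is given radius
    0. *)
Definition covered {T : Type} (d : T -> T -> R) (t e : R) (A : set T) : Prop :=
  exists (U : nat -> set T) (r : nat -> R),
    [/\ A `<=` \bigcup_i U i, forall i, 0 <= r i,
        forall i x y, U i x -> U i y -> d x y <= r i &
        (\sum_(i <oo) (r i `^ t)%:E <= e%:E)%E].

(** No bound on the mesh is imposed: for [t > 0] a small Hausdorff sum already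
    forces every radius to be small. *)
Definition null {T : Type} (d : T -> T -> R) (t : R) (A : set T) : Prop :=
  forall e, 0 < e -> covered d t e A.

Lemma powR_le_cancel (t r c : R) : 0 < t -> 0 <= r -> 0 <= c -> r `^ t <= c `^ t -> r <= c.
Proof.
move=> t0 r0 c0; rewrite !leNgt; apply: contraNN => cr.
by apply: gt0_ltr_powR; rewrite ?nnegrE // ?ltW.
Qed.

Lemma le_nneseries_term (a : nat -> \bar R) (i : nat) :
  (forall n, 0 <= a n)%E -> (a i <= \sum_(n <oo) a n)%E.
Proof.
move=> a0; apply: (le_trans _ (@nneseries_lim_ge _ _ xpredT 0 i.+1 _)) => //.
by rewrite big_nat_recr //= leeDr // sume_ge0.
Qed.

Section OneMetric.
Context {T : Type}.
Variable d : T -> T -> R.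
Implicit Types (A B : set T) (t e : R).

Lemma covered_mono t e e' A B : A `<=` B -> e' <= e ->
  covered d t e' B -> covered d t e A.
Proof.
move=> AB ee' [U [r [BU r0 rU rs]]]; exists U, r; split => //.
  exact: subset_trans BU.
by apply: le_trans rs _; rewrite lee_fin.
Qed.

(** Covers may be indexed by any countable type; indices outside the image of
    [pickle] receive the empty set with radius 0, which costs nothing since
    [t > 0]. *)
Lemma covered_countable (I : countType) (U : I -> set T) (r : I -> R) t e A :
  0 < t -> A `<=` \bigcup_i U i -> (forall i, 0 <= r i) ->
  (forall i x y, U i x -> U i y -> d x y <= r i) ->
  (\esum_(i in setT) (r i `^ t)%:E <= e%:E)%E -> covered d t e A.
Proof.
move=> t0 AU r0 rU rs.
pose U' n := if @pickle_inv I n is Some i then U i else set0.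
pose r' n := if @pickle_inv I n is Some i then r i else 0.
exists U', r'; split.
- by move=> x /AU[i _ Ui]; exists (pickle i) => //; rewrite /U' pickleK_inv.
- by move=> n; rewrite /r'; case: pickle_inv.
- by move=> n x y; rewrite /U' /r'; case: pickle_inv => // i; exact: rU.
rewrite nneseries_esumT; last by move=> n; rewrite lee_fin powR_ge0.
suff -> : (\esum_(i in [set: nat]) (r' i `^ t)%:E)%E
    = (\esum_(i in [set: I]) (r i `^ t)%:E)%E by [].
transitivity (\esum_(n in range (@pickle I)) (r' n `^ t)%:E)%E; last first.
  rewrite esum_image; last by move=> x y _ _ /(pcan_inj (@pickleK_inv I)).
  by apply: eq_esum => i _; rewrite /r' pickleK_inv.
rewrite [RHS]esum_mkcond; apply: eq_esum => n _; case: ifPn => // nn.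
rewrite /r'; case En: (@pickle_inv I n) => [i|]; last by rewrite powR0 // gt_eqF.
case/negP: nn; apply/mem_set; exists i => //.
by have := @pickle_invK I n; rewrite En.
Qed.

Lemma covered_bigcup t (e : nat -> R) c (A : nat -> set T) : 0 < t ->
  (forall n, covered d t (e n) (A n)) -> (\sum_(n <oo) (e n)%:E <= c%:E)%E ->
  covered d t c (\bigcup_n A n).
Proof.
move=> t0 /choice[U /choice[r H]] ec.
apply: (@covered_countable (nat * nat)%type (fun p => U p.1 p.2) (fun p => r p.1 p.2)) => //.
- move=> x [n _]; have [+ _ _ _] := H n => /[apply] -[k _ Ux].
  by exists (n, k).
- by move=> [n k]; have [_ + _ _] := H n; exact.
- by move=> [n k]; have [_ _ + _] := H n; exact.
have -> : [set: nat * nat] = [set: nat] `*`` (fun=> [set: nat]) by apply/seteqP.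
rewrite -(@esum_esum _ _ _ _ _ (fun n k => (r n k `^ t)%:E)); last first.
  by move=> i k _ _; rewrite lee_fin powR_ge0.
apply: le_trans ec; rewrite -nneseries_esumT; last first.
  by move=> n; apply: esum_ge0 => k _; rewrite lee_fin powR_ge0.
apply: lee_nneseries => [n _ _|n _]; first by apply: esum_ge0 => k _; rewrite lee_fin powR_ge0.
rewrite -nneseries_esumT; last by move=> k; rewrite lee_fin powR_ge0.
by have [_ _ _] := H n.
Qed.

Lemma covered_fin (F : finType) t e (A : F -> set T) : 0 < t ->
  (forall c, covered d t e (A c)) -> covered d t (#|F|%:R * e) (\bigcup_c A c).
Proof.
move=> t0 /choice[U /choice[r H]].
apply: (@covered_countable (F * nat)%type (fun p => U p.1 p.2) (fun p => r p.1 p.2)) => //.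
- move=> x [n _]; have [+ _ _ _] := H n => /[apply] -[k _ Ux].
  by exists (n, k).
- by move=> [n k]; have [_ + _ _] := H n; exact.
- by move=> [n k]; have [_ _ + _] := H n; exact.
have -> : [set: F * nat] = [set: F] `*`` (fun=> [set: nat]) by apply/seteqP.
rewrite -(@esum_esum _ _ _ _ _ (fun n k => (r n k `^ t)%:E)); last first.
  by move=> i k _ _; rewrite lee_fin powR_ge0.
apply: (@le_trans _ _ (\esum_(c in [set: F]) e%:E)%E).
  apply: le_esum => c _; rewrite -nneseries_esumT; last by move=> k; rewrite lee_fin powR_ge0.
  by have [_ _ _] := H c.
have e0 : forall c : F, 0 <= e.
  move=> c; have [_ _ _ h] := H c; rewrite -lee_fin; apply: le_trans h.
  by apply: nneseries_ge0 => n _ _; rewrite lee_fin powR_ge0.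
rewrite esum_fset; [|exact: finite_finset|by move=> c _; rewrite lee_fin (e0 c)].
rewrite (@fsbigE _ _ _ _ _ (enum F)) ?enum_uniq //; last first.
  by move=> c _; rewrite mem_enum inE.
rewrite big_mkcond (eq_bigr (fun=> e%:E)); last by move=> c _; rewrite in_setT.
by rewrite sumEFin lee_fin big_const_seq count_predT iter_addr_0 -cardE mulr_natl.
Qed.

Lemma null_sub t A B : A `<=` B -> null d t B -> null d t A.
Proof. by move=> AB nB e /nB; apply: covered_mono. Qed.

Lemma null_bigcup t (A : nat -> set T) : 0 < t ->
  (forall n, null d t (A n)) -> null d t (\bigcup_n A n).
Proof.
move=> t0 nA e e0.
apply: (@covered_bigcup _ (fun n => e / (2 ^ n.+1)%:R)) => //.
  by move=> n; apply: nA; rewrite divr_gt0 // ltr0n expn_gt0.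
have := epsilon_trick xpredT (fun n => lexx (0 : \bar R)) (ltW e0).
rewrite [X in (_ <= X + _)%E]eseries0 // add0e; apply: le_trans.
by apply: lee_nneseries => n *; rewrite ?add0e // lee_fin divr_ge0 // ltW.
Qed.

Lemma null_fin (F : finType) t (A : F -> set T) : 0 < t ->
  (forall c, null d t (A c)) -> null d t (\bigcup_c A c).
Proof.
move=> t0 nA e e0; have F0 : 0 < (#|F|.+1%:R : R) by [].
apply: (@covered_mono _ _ (#|F|%:R * (e / #|F|.+1%:R)) _ (\bigcup_c A c)) => //.
  by rewrite mulrCA ger_pMr // ler_pdivrMr // mul1r ler_nat.
by apply: covered_fin => // c; apply: nA; rewrite divr_gt0.
Qed.

Lemma nullU t A B : 0 < t -> null d t A -> null d t B -> null d t (A `|` B).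
Proof.
move=> t0 nA nB; apply: (@null_sub _ _ (\bigcup_(b : bool) (if b then A else B))).
  by move=> x [Ax|Bx]; [exists true|exists false].
by apply: null_fin => // -[].
Qed.

Lemma null_le t u A : 0 < t -> t <= u -> null d t A -> null d u A.
Proof.
move=> t0 tu nA e e0.
have [|U [r [AU r0 rU rs]]] := nA (Num.min e 1); first by rewrite lt_min e0 ltr01.
exists U, r; split => //.
have r1 i : r i <= 1.
  apply: (@powR_le_cancel t) => //; rewrite powR1 -lee_fin.
  apply: le_trans (le_trans rs _); last by rewrite lee_fin ge_min lexx orbT.
  by apply: (@le_nneseries_term (fun n => (r n `^ t)%:E)) => n; rewrite lee_fin powR_ge0.
apply: (le_trans (le_trans _ rs)); last by rewrite lee_fin ge_min lexx.
apply: lee_nneseries => n _; rewrite ?lee_fin ?powR_ge0 //.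
have [->|rn] := eqVneq (r n) 0; first by rewrite !powR0 ?gt_eqF // (lt_le_trans t0).
by apply: ger_powR => //; rewrite r1 andbT lt_neqAle eq_sym rn r0.
Qed.

Hypothesis d0 : forall x y, 0 <= d x y.

Lemma diam_ge0 (U : set T) x : U x -> (0 <= diam d U)%E.
Proof.
move=> Ux; apply: (@le_trans _ _ (d x x)%:E); first by rewrite lee_fin.
by apply: ereal_sup_ubound; exists x, x.
Qed.

Lemma hgauge_ge0 t (U : set T) : (0 <= hgauge d t U)%E.
Proof. by rewrite /hgauge; case: ifP => // _; exact: poweR_ge0. Qed.

Lemma hcontent_ge0 c t A : (0 <= hcontent d c t A)%E.
Proof.
apply: le_ereal_inf_tmp => _ [U _ <-]; apply: nneseries_ge0 => n _ _.
exact: hgauge_ge0.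
Qed.

Lemma hmeasure_ge0 t A : (0 <= hmeasure d t A)%E.
Proof.
apply: (le_trans (hcontent_ge0 1 t A)); apply: ereal_sup_ubound.
by exists 1 => //=; exact: ltr01.
Qed.

Lemma hmeasure_gt0 t A : (0 < hmeasure d t A)%E <-> hmeasure d t A <> 0%E.
Proof.
by rewrite lt_neqAle hmeasure_ge0 andbT eq_sym; split => /eqP.
Qed.

Lemma hmeasure0_cover t A e : hmeasure d t A = 0%E -> 0 < e ->
  exists2 U, delta_cover d 1 A U & (\sum_(i <oo) hgauge d t (U i) < e%:E)%E.
Proof.
move=> A0 e0; have : (hcontent d 1 t A < e%:E)%E.
  apply: (@le_lt_trans _ _ 0%E); last by rewrite lte_fin.
  by rewrite -A0; apply: ereal_sup_ubound; exists 1 => //=; exact: ltr01.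
by move=> /ereal_inf_lt[_ [U dU <-] Ue]; exists U.
Qed.

(** From right to left, a cover whose sum is at most [c `^ t] has all its radii
    at most [c], so it competes in the content of mesh [c]. *)
Lemma hmeasure_eq0P t A : 0 < t -> hmeasure d t A = 0%E <-> null d t A.
Proof.
move=> t0; split.
  move=> A0 e e0; have [U [AU U1] Ue] := hmeasure0_cover A0 e0.
  pose r i := if `[< U i = set0 >] then 0 else fine (diam d (U i)).
  have rE i : hgauge d t (U i) = (r i `^ t)%:E.
    rewrite /hgauge /r; case: asboolP => [_|/eqP/set0P[x Ux]].
      by rewrite powR0 // gt_eqF.
    rewrite -poweR_EFin fineK // ge0_fin_numE ?(diam_ge0 Ux) //.
    by apply: le_lt_trans (U1 i) _; exact: ltry.
  exists U, r; split => //.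
  - move=> i; rewrite /r; case: asboolP => // /eqP/set0P[x Ux].
    by apply: fine_ge0; apply: diam_ge0 Ux.
  - move=> i x y Ux Uy; rewrite /r; case: asboolP => [U0|_]; first by move: Ux; rewrite U0.
    rewrite -lee_fin fineK; last first.
      rewrite ge0_fin_numE ?(diam_ge0 Ux) //.
      by apply: le_lt_trans (U1 i) _; exact: ltry.
    by apply: ereal_sup_ubound; exists x, y.
  - by under eq_eseriesr do rewrite -rE; exact: ltW.
move=> nA; apply/eqP; rewrite eq_le hmeasure_ge0 andbT.
apply: ge_ereal_sup => _ [c /= c0 <-].
apply/lee_addgt0Pr => e e0; rewrite add0e.
have [|U [r [AU r0 rU rs]]] := nA (Num.min e (c `^ t)).
  by rewrite lt_min e0 powR_gt0.
have rc i : r i <= c.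
  apply: (@powR_le_cancel t) => //; first exact: ltW.
  rewrite -lee_fin.
  apply: le_trans (le_trans rs _); last by rewrite lee_fin ge_min lexx orbT.
  by apply: (@le_nneseries_term (fun n => (r n `^ t)%:E)) => n; rewrite lee_fin powR_ge0.
have diamr i : (diam d (U i) <= (r i)%:E)%E.
  by apply: ge_ereal_sup => _ [x [y [Ux Uy ->]]]; rewrite lee_fin; apply: rU Ux Uy.
apply: (@le_trans _ _ (\sum_(i <oo) hgauge d t (U i))%E).
  apply: ereal_inf_lbound; exists U => //; split => // i.
  by apply: le_trans (diamr i) _; rewrite lee_fin.
apply: (le_trans (le_trans _ rs)); last by rewrite lee_fin ge_min lexx.
apply: lee_nneseries => [i _ _|i _]; first exact: hgauge_ge0.
rewrite /hgauge; case: asboolP => [_|/eqP/set0P[x Ux]]; first by rewrite lee_fin powR_ge0.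
rewrite -poweR_EFin; apply: gt0_ler_poweR => //; first exact: ltW.
  by rewrite in_itv /= (diam_ge0 Ux) leey.
by rewrite in_itv /= lee_fin r0 leey.
Qed.

(** In exponent 0 each nonempty set of a cover costs 1. *)
Lemma hmeasure0_eq0P A : hmeasure d 0 A = 0%E <-> A = set0.
Proof.
split=> [A0|->].
  have [U [AU _] Ue] := hmeasure0_cover A0 ltr01.
  apply/seteqP; split => // x /AU[i _ Ux].
  have := le_lt_trans (@le_nneseries_term (fun n => hgauge d 0 (U n)) i (fun n => hgauge_ge0 _ _)) Ue.
  rewrite /hgauge poweRe0; case: asboolP => [U0|]; last by rewrite ltxx.
  by move: Ux; rewrite U0.
apply/eqP; rewrite eq_le hmeasure_ge0 andbT.
apply: ge_ereal_sup => _ [c /= c0 <-].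
apply: ereal_inf_lbound; exists (fun=> set0); last first.
  by rewrite eseries0 // => i _ _; rewrite /hgauge asboolT.
split => // i; apply: ge_ereal_sup => _ [x [y [//]]].
Qed.

Lemma hdim_ge0 A : (0 <= hdim d A)%E.
Proof. by apply: le_ereal_inf_tmp => _ [t [t0 _] <-]; rewrite lee_fin. Qed.

Lemma hdim_le t A : 0 < t -> null d t A -> (hdim d A <= t%:E)%E.
Proof.
move=> t0 nA; apply: ereal_inf_lbound; exists t => //; split; first exact: ltW.
exact/hmeasure_eq0P.
Qed.

Lemma null_hdim t A : (hdim d A < t%:E)%E -> null d t A.
Proof.
move=> /ereal_inf_lt[_ [u [u0 Au] <-]]; rewrite lte_fin => ut.
have [u00|u00] := eqVneq u 0.
  move: Au; rewrite u00 => /hmeasure0_eq0P -> e e0.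
  exists (fun=> set0), (fun=> 0); split => //.
  by rewrite eseries0 ?lee_fin ?ltW // => i _ _; rewrite powR0 // gt_eqF // (le_lt_trans u0).
have u_gt0 : 0 < u by rewrite lt_neqAle eq_sym u00.
by apply: (null_le u_gt0 (ltW ut)); apply/hmeasure_eq0P.
Qed.

Lemma hdim_ge t A : ~ null d t A -> (t%:E <= hdim d A)%E.
Proof. by move=> nA; rewrite leNgt; apply/negP => /null_hdim. Qed.

End OneMetric.

Section TwoMetrics.
Context {T T' : Type}.
Variables (d : T -> T -> R) (d' : T' -> T' -> R).
Variables (A : set T) (A' : set T').

(** A relation rather than a map: below, a flat is recovered from its
    coordinates, or from its power, without having to name an inverse map. *)
Lemma null_lipschitz (rho : T -> T' -> Prop) (L t : R) : 0 < t -> 0 < L ->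
  (forall y, A' y -> exists2 x, A x & rho x y) ->
  (forall x y x' y', rho x y -> rho x' y' -> d' y y' <= L * d x x') ->
  null d t A -> null d' t A'.
Proof.
move=> t0 L0 AA' lip nA e e0.
have [|U [r [AU r0 rU rs]]] := nA (e / L `^ t); first by rewrite divr_gt0 // powR_gt0.
exists (fun i => [set y | exists2 x, U i x & rho x y]), (fun i => L * r i); split.
- by move=> y /AA'[x /AU[i _ Ux] xy]; exists i => //; exists x.
- by move=> i; rewrite mulr_ge0 // ltW.
- move=> i y y' [x Ux xy] [x' Ux' xy']; apply: le_trans (lip _ _ _ _ xy xy') _.
  by rewrite ler_pM2l //; apply: rU Ux Ux'.
have -> : (\sum_(i <oo) ((L * r i) `^ t)%:E = \sum_(i <oo) (L `^ t)%:E * (r i `^ t)%:E)%E.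
  by apply: eq_eseriesr => i _; rewrite -EFinM powRM // ltW.
rewrite nneseriesZl; last by move=> n _; rewrite lee_fin powR_ge0.
apply: (@le_trans _ _ ((L `^ t)%:E * (e / L `^ t)%:E)%E).
  by rewrite lee_wpmul2l // lee_fin powR_ge0.
by rewrite -EFinM mulrC divfK // gt_eqF // powR_gt0.
Qed.

End TwoMetrics.
End NullSets.
Arguments hmeasure_gt0 {R T d} t A.
Arguments hmeasure0_eq0P {R T d} A.
Arguments hmeasure_eq0P {R T d} d0 {t} A.
Arguments hdim_ge0 {R T d} A.

(** * Thinning a weighted cover *)

Section Thinning.
Context {R : realType} {T : Type}.
Variables (A : set T) (C : nat -> set T) (j : nat -> nat) (w g : nat -> R).
Hypothesis w0 : forall i, 0 <= w i.
Hypothesis g0 : forall i, 0 <= g i.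
Hypothesis nested : forall i i', (j i <= j i')%N -> C i `&` C i' !=set0 ->
  C i' `<=` C i.

(** Sets of lower level, which are the large ones, come first. *)
Let pr i' i := (j i' < j i)%N || ((j i' == j i) && (i' < i)%N).
(** The strict ancestors of i: the earlier sets that contain C i. For a point x
   of C i, they are exactly the earlier sets that contain x. The cumulative
   weights before and after C i are a i and b i. *)
Let anc i i' := pr i' i && `[< C i `<=` C i' >].
Let a i := (\sum_(n <oo | anc i n) (w n)%:E)%E.
Let b i := (a i + (w i)%:E)%E.

(** Stated so that [//] discharges the side conditions on nonnegative series. *)
Let wE0 n : (0 <= (w n)%:E)%E. Proof. by rewrite lee_fin. Qed.

Let last_pr (P : pred nat) N : 
  (exists m, P m /\ forall i, (i < N)%N -> P i -> i = m \/ pr i m) \/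
  (forall i, (i < N)%N -> ~~ P i).
Proof.
elim: N => [|N [[m [Pm H]]|H]]; first by right.
- have [PN|PN] := boolP (P N); last first.
    left; exists m; split => // i; rewrite ltnS leq_eqVlt => /orP[/eqP->|]; last exact: H.
    by rewrite (negPf PN).
  left; have [NmE|Nm] := eqVneq N m.
    by exists m; split => // i; rewrite ltnS leq_eqVlt => /orP[/eqP->|]; [left|apply: H].
  have [prN|prN] := boolP (pr N m).
    by exists m; split => // i; rewrite ltnS leq_eqVlt => /orP[/eqP->|]; [right|apply: H].
  exists N; split => // i; rewrite ltnS leq_eqVlt => /orP[/eqP->|]; first by left.
  move=> iN Pi; right; case: (H i iN Pi) => [->|]; move: prN Nm; rewrite /pr; lia.
- have [PN|PN] := boolP (P N).
    left; exists N; split => // i; rewrite ltnS leq_eqVlt => /orP[/eqP->|]; first by left.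
    by move=> iN; rewrite (negPf (H i iN)).
  by right => i; rewrite ltnS leq_eqVlt => /orP[/eqP->//|]; apply: H.
Qed.

(** The sets of the family P form a chain, as they all contain x. If their total
   weight exceeds th, so does a finite partial sum, and the last set m of that
   finite family has all the others among its ancestors. *)
Let heavy_cum x (P : pred nat) (th : R) : 0 <= th -> (forall n, P n -> C n x) ->
  (th%:E < \sum_(n <oo | P n) (w n)%:E)%E -> exists m, P m /\ (th%:E < b m)%E.
Proof.
move=> th0 PC thP.
have [N thN] : exists N, (th%:E < \sum_(0 <= n < N | P n) (w n)%:E)%E.
  apply/not_existsP => H; move: thP; apply/negP; rewrite -leNgt.
  apply: lime_le; first exact: is_cvg_nneseries.
  by apply: nearW => N; rewrite leNgt; apply/negP; apply: H.
have [[m [Pm H]]|H] := last_pr P N; last first.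
  move: thN; rewrite big_nat_cond big_pred0 ?lte_fin ?ltNge ?th0 // => i.
  by apply/negbTE/negP => /andP[/= iN]; apply/negP; apply: H.
exists m; split => //; apply: (lt_le_trans thN).
have -> : b m = (\sum_(n <oo | (n == m) || anc m n) (w n)%:E)%E.
  rewrite (@nneseriesD1 _ _ m) ?eqxx // addeC; congr (_ + _)%E.
  apply: eq_eseriesl => n; case: eqVneq => [->|]; rewrite /= ?andbT //.
  by rewrite /anc /pr ltnn eqxx ltnn.
apply: (le_trans _ (nneseries_lim_ge N _)) => //.
rewrite big_mkcond [leRHS]big_mkcond big_nat [leRHS]big_nat /=; apply: lee_sum => i iN.
case: ifPn => Pi; case: ifPn => // /negP[].
case: (H i iN Pi) => [->|prm]; first by rewrite eqxx.
rewrite /anc prm /= ; apply/orP; right; apply/asboolP; apply: nested.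
  by move: prm; rewrite /pr; lia.
by exists x; split; apply: PC.
Qed.

(** The first set at x whose cumulative weight exceeds th: the weight before it
   is at most th, since otherwise [heavy_cum], applied to its ancestors, would
   give an earlier one. *)
Let selected x (th : R) : 0 <= th ->
  (th%:E < \sum_(n <oo | `[< C n x >]) (w n)%:E)%E ->
  exists i, C i x /\ (a i <= th%:E < b i)%E.
Proof.
move=> th0 thC.
pose Q m := `[< C m x >] && (th%:E < b m)%E.
have [m0 Qm0] : exists m, Q m.
  have [m []] := heavy_cum th0 (fun n => @asboolW (C n x)) thC.
  by move=> Cm bm; exists m; rewrite /Q Cm bm.
have exj : exists l, `[< exists m, Q m /\ j m = l >].
  by exists (j m0); apply/asboolP; exists m0.
case: (ex_minnP exj) => l /asboolP[m1 [Qm1 jm1]] minl.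
have exi : exists m, Q m && (j m == l) by exists m1; rewrite Qm1 jm1 eqxx.
case: (ex_minnP exi) => i /andP[/andP[/asboolP Cix bi] /eqP ji] mini.
exists i; split => //; rewrite bi andbT leNgt; apply/negP => ai.
have [m [/andP[prm /asboolP Cm] bm]] : exists m, anc i m /\ (th%:E < b m)%E.
  by apply: (heavy_cum (x := x) th0 _ ai) => n /andP[_ /asboolP]; exact.
have Qm : Q m by rewrite /Q bm andbT; apply/asboolP/Cm.
have lm : (l <= j m)%N by apply: minl; apply/asboolP; exists m.
have := mini m; rewrite Qm /=; move: prm; rewrite /pr; lia.
Qed.

(** Fix a threshold th in [0, kappa[ and keep the sets at which the cumulative
    weight crosses th. Every point of A lies in such a set, because the sets
    that contain it weigh at least kappa. A set of weight w_i is kept for a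
    range of thresholds of length at most w_i, so that the cost of the kept
    sets, integrated over th, is at most the sum of the w_i g_i, which is less
    than kappa K: some threshold costs at most K. *)
Lemma weighted_thinning (kappa K : R) : 0 < kappa ->
  (forall x, A x -> kappa%:E <= \sum_(n <oo | `[< C n x >]) (w n)%:E)%E ->
  (\sum_(n <oo) (w n * g n)%:E < (kappa * K)%:E)%E ->
  exists I : pred nat, A `<=` \bigcup_(i in [set i | I i]) C i /\
    (\sum_(n <oo | I n) (g n)%:E <= K%:E)%E.
Proof.
move=> k0 heavy sumwg.
pose J n : set R := [set th | a n <= th%:E < b n]%E.
have JE n : J n = set0 \/ exists c, J n = [set` `[c, c + w n[].
  have : (0 <= a n)%E by apply: nneseries_ge0.
  rewrite /J /b; case: (a n) => [c _|_|//].
    by right; exists c; apply/seteqP; split => th /=; rewrite in_itv /= -EFinD lee_fin lte_fin.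
  by left; apply/seteqP; split => th //=; rewrite leye_eq.
have mJ n : measurable (J n) by case: (JE n) => [->|[c ->]].
have muJ n : (lebesgue_measure (J n) <= (w n)%:E)%E.
  case: (JE n) => [->|[c ->]]; first by rewrite measure0.
  rewrite lebesgue_measure_itv /= lte_fin; case: ifP => // _.
  by rewrite -EFinD addrC addKr.
pose F n th := ((g n)%:E * (\1_(J n) th)%:E)%E.
have F0 n th : (0 <= F n th)%E by rewrite mule_ge0 // lee_fin // g0.
have FE th : (\sum_(n <oo) F n th = \sum_(n <oo | (a n <= th%:E < b n)%E) (g n)%:E)%E.
  rewrite [RHS]eseries_mkcond; apply: eq_eseriesr => n _.
  rewrite /F indicE; case: ifPn => [H|/negP H]; first by rewrite mem_set // mule1.
  by rewrite memNset ?mule0.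
have [th [thk H]] : exists th, 0 <= th < kappa /\ (\sum_(n <oo) F n th <= K%:E)%E.
  apply: contrapT => /forallNP H; move: sumwg; apply/negP; rewrite -leNgt.
  pose D : set R := [set` `[0, kappa[].
  have mD : measurable D by exact: measurable_itv.
  have m1 n : measurable_fun D (EFin \o (\1_(J n) : R -> R)) by apply/measurable_EFinP; exact: measurable_indic.
  have mF n : measurable_fun D (F n) by apply: (measurable_funeM (g n)%:E (m1 n)).
  have muD : lebesgue_measure D = kappa%:E.
    by rewrite lebesgue_measure_itv /= lte_fin k0 -EFinD subr0.
  have intK : (\int[lebesgue_measure]_(th in D) (cst K%:E th) = (kappa * K)%:E)%E.
    transitivity (K%:E * lebesgue_measure D)%E; first exact: (integral_cst lebesgue_measure mD).
    by rewrite muD -EFinM mulrC.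
  have [K0|K0] := ltP K 0.
    apply: (@le_trans _ _ 0%E); last by apply: nneseries_ge0 => n *; rewrite lee_fin mulr_ge0.
    by rewrite lee_fin; apply: mulr_ge0_le0; apply: ltW.
  rewrite -intK; apply: (@le_trans _ _ (\int[lebesgue_measure]_(th in D) (\sum_(n <oo) F n th))%E).
    have mS : measurable_fun D (fun th => \sum_(n <oo) F n th)%E.
      by apply: ge0_emeasurable_sum => n *; [exact: F0|exact: mF].
    apply: ge0_le_integral.
    - exact: mD.
    - by move=> th _; rewrite lee_fin.
    - exact: measurable_cst.
    - exact: mS.
    - move=> th; rewrite /D /= in_itv /= => thD; rewrite leNgt; apply/negP => /ltW.
      by move=> ?; apply: (H th).
  rewrite integral_nneseries //; apply: lee_nneseries => [n _ _|n _].
    by apply: integral_ge0 => th _; apply: F0.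
  rewrite (ge0_integralZl_EFin lebesgue_measure mD _ (m1 n) (g0 n)); last by move=> th _; rewrite lee_fin.
  rewrite [X in (_ * X)%E](integral_indic lebesgue_measure mD (mJ n)).
  rewrite mulrC EFinM; apply: lee_wpmul2l; first by rewrite lee_fin.
  apply: (le_trans _ (muJ n)); apply: le_measure; rewrite ?inE.
  - exact: (measurableI _ _ (mJ n) mD).
  - exact: (mJ n).
  - by move=> x [].
exists (fun n => (a n <= th%:E < b n)%E); split; last by rewrite -FE.
move=> x /heavy kx; have [|| i [Ci ai]] := @selected x th.
- by case/andP: thk.
- by apply: lt_le_trans kx; rewrite lte_fin; case/andP: thk.
- by exists i.
Qed.

End Thinning.

(** * Euclidean distance and dyadic scales *)

Section DyadicCubes.
Context {R : realType}.

Lemma eucl_dist_ge0 n (x y : 'rV[R]_n) : 0 <= eucl_dist x y.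
Proof. exact: sqrtr_ge0. Qed.

Lemma enorm_coord n (x : 'rV[R]_n) l : `|x 0 l| <= enorm x.
Proof.
rewrite /enorm -sqrtr_sqr ler_wsqrtr // (bigD1 l) //= lerDl.
by apply: sumr_ge0 => i _; rewrite sqr_ge0.
Qed.

Lemma eucl_dist_coord n (x y : 'rV[R]_n) l : `|x 0 l - y 0 l| <= eucl_dist x y.
Proof. by apply: le_trans (enorm_coord _ l); rewrite !mxE. Qed.

Lemma enorm_le n (x : 'rV[R]_n) c : 0 <= c ->
  (forall l, `|x 0 l| <= c) -> enorm x <= n%:R * c.
Proof.
move=> c0 H; rewrite -[leRHS]ger0_norm ?mulr_ge0 // -sqrtr_sqr ler_wsqrtr //.
apply: (@le_trans _ _ (\sum_(i < n) c ^+ 2)).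
  apply: ler_sum => i _; rewrite -real_normK ?num_real //.
  by apply: lerXn2r; rewrite ?nnegrE.
rewrite sumr_const card_ord exprMn -[leLHS]mulr_natl ler_wpM2r ?sqr_ge0 //.
by rewrite -natrX ler_nat; case: n {x H} => // n; rewrite expnS expn1 leq_pmulr.
Qed.

Lemma eucl_dist_le n (x y : 'rV[R]_n) c : 0 <= c ->
  (forall l, `|x 0 l - y 0 l| <= c) -> eucl_dist x y <= n%:R * c.
Proof. by move=> c0 H; apply: enorm_le => // l; rewrite !mxE. Qed.

Lemma dyadic_bracket (r : R) : 0 < r <= 1 ->
  exists j : nat, r <= 2^-1 ^+ j /\ 2^-1 ^+ j <= 2 * r.
Proof.
move=> /andP[r0 r1].
have exj : exists j, 2^-1 ^+ j < r :> R.
  have [n] := @ltr_add_invr R 0 r r0; rewrite add0r => nr; exists n.+1.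
  apply: le_lt_trans nr; rewrite exprVn lef_pV2 ?posrE ?exprn_gt0 //.
  by rewrite -natrX ler_nat ltnW // ltn_expl.
case: (ex_minnP exj) => -[|j] jr minj; first by rewrite expr0 ltNge r1 in jr.
exists j; split.
  by rewrite leNgt; apply/negP => /minj; rewrite ltnn.
by move: jr; rewrite exprS -ltr_pdivlMl ?invr_gt0 // invrK => /ltW.
Qed.

Lemma powR_ge1 (a t : R) : 1 <= a -> 0 <= t -> 1 <= a `^ t.
Proof.
move=> a1 t0; have <- : 1 `^ t = 1 :> R by rewrite powR1.
by apply: ge0_ler_powR; rewrite ?nnegrE // (le_trans ler01).
Qed.

Lemma powR_le1 (a t : R) : 0 <= a <= 1 -> 0 <= t -> a `^ t <= 1.
Proof.
move=> /andP[a0 a1] t0; have <- : 1 `^ t = 1 :> R by rewrite powR1.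
by apply: ge0_ler_powR; rewrite ?nnegrE.
Qed.

(** The radius is rounded up to a power of 1/2, and it must first be made
    positive: a small geometric sequence is added to the terms r_i^t of the
    sum. *)
Lemma null_dyadic {T : Type} (d : T -> T -> R) t (A : set T) e : 0 < t -> 0 < e ->
  null d t A -> exists (U : nat -> set T) (j : nat -> nat),
  [/\ A `<=` \bigcup_i U i, forall i x y, U i x -> U i y -> d x y <= 2^-1 ^+ j i &
    (\sum_(i <oo) ((2^-1 ^+ j i) `^ t)%:E <= e%:E)%E].
Proof.
move=> t0 e0 nA.
pose m := Num.min e 1; have m0 : 0 < m by rewrite lt_min e0 ltr01.
have p1 : 1 <= 2 `^ t :> R by apply: powR_ge1; rewrite ?ltW ?ltr1n.
have p0 : 0 < 2 `^ t :> R by apply: lt_le_trans p1.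
pose e' := m / (2 `^ t) / 2.
have e'0 : 0 < e' by rewrite !divr_gt0.
have [U [r [AU r0 rU rs]]] := nA _ e'0.
pose a i := r i `^ t + e' / (2 ^ i.+1)%:R.
have a0 i : 0 < a i by rewrite ltr_wpDl ?powR_ge0 // divr_gt0 // ltr0n expn_gt0.
have rte i : r i `^ t <= e'.
  rewrite -lee_fin; apply: le_trans rs.
  by apply: (@le_nneseries_term _ (fun n => (r n `^ t)%:E)) => n; rewrite lee_fin powR_ge0.
have a1 i : a i <= 1.
  apply: (@le_trans _ _ (e' + e')).
    by apply: lerD => //; rewrite ler_pdivrMr ?ltr0n ?expn_gt0 // ler_peMr ?(ltW e'0) ?ler1n ?expn_gt0.
  rewrite /e' -splitr ler_pdivrMr // mul1r; apply: le_trans p1.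
  by rewrite /m ge_min lexx orbT.
have /choice[j jP] : forall i, exists j : nat, a i `^ t^-1 <= 2^-1 ^+ j /\ 2^-1 ^+ j <= 2 * a i `^ t^-1.
  move=> i; apply: dyadic_bracket; rewrite powR_gt0 //=.
  by apply: powR_le1; rewrite ?a1 ?invr_ge0 ?ltW.
have aK i : (a i `^ t^-1) `^ t = a i by rewrite -powRrM mulVf ?gt_eqF // powRr1 // ltW.
exists U, j; split => //.
  move=> i x y Ux Uy; apply: (le_trans (rU _ _ _ Ux Uy)); apply: le_trans (jP i).1.
  apply: (powR_le_cancel t0) => //; first exact: powR_ge0.
  by rewrite aK lerDl divr_ge0 // ltW.
apply: (@le_trans _ _ (\sum_(i <oo) ((2 `^ t)%:E * ((r i `^ t)%:E + (e' / (2 ^ i.+1)%:R)%:E))))%E.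
  apply: lee_nneseries => [i _ _|i _]; first by rewrite lee_fin powR_ge0.
  rewrite -EFinD -EFinM lee_fin -/(a i) -[in leRHS](aK i) -powRM ?powR_ge0 //.
  apply: ge0_ler_powR; rewrite ?nnegrE; [exact: ltW| | |exact: (jP i).2].
    by rewrite exprn_ge0.
  by rewrite mulr_ge0 // powR_ge0.
rewrite nneseriesZl; last by move=> i _; rewrite -EFinD lee_fin ltW // a0.
apply: (@le_trans _ _ ((2 `^ t)%:E * (e'%:E + e'%:E)))%E.
  apply: lee_wpmul2l; first by rewrite lee_fin ltW.
  apply: le_trans (epsilon_trick _ _ (ltW e'0)) _; first by move=> n; rewrite lee_fin powR_ge0.
  by rewrite leeD2r.
rewrite -EFinD -EFinM lee_fin /e' -splitr mulrC divfK ?gt_eqF //.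
by rewrite /m ge_min lexx.
Qed.

(** Each cell of a grid lies in a single cell of a grid that is M times
    coarser. *)
Lemma floor_scale (M : nat) (u v : R) : (0 < M)%N ->
  Num.floor (M%:R * u) = Num.floor (M%:R * v) -> Num.floor u = Num.floor v.
Proof.
have key (a b : R) : (0 < M)%N ->
    Num.floor (M%:R * a) = Num.floor (M%:R * b) -> Num.floor b <= Num.floor a.
  move=> M0 E; rewrite leNgt; apply/negP => ab.
  have ab1 : (Num.floor a + 1 <= Num.floor b) by rewrite lezD1.
  have : Num.floor (M%:R * a) < M%:Z * Num.floor b.
    rewrite floor_lt_int rmorphM /= -pmulrn ltr_pM2l ?ltr0n //.
    apply: lt_le_trans (floorD1_gt a) _.
    by rewrite ler_int.
  rewrite E ltNge => /negP; apply.
  rewrite floor_ge_int rmorphM /= -pmulrn ler_pM2l ?ltr0n //.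
  exact: floor_le.
by move=> M0 E; apply/eqP; rewrite eq_le !key.
Qed.

Lemma floor_close (u v : R) : `|u - v| <= 1 ->
  (`|Num.floor u - Num.floor v| <= 1)%R.
Proof.
rewrite !ler_norml => /andP[h1 h2].
have [a1 a2] := (floor_le u, floorD1_gt u).
have [b1 b2] := (floor_le v, floorD1_gt v).
have c1 : Num.floor u < Num.floor v + 2.
  by rewrite -(ltr_int R) rmorphD /=; rewrite rmorphD /= in b2; lra.
have c2 : Num.floor v < Num.floor u + 2.
  by rewrite -(ltr_int R) rmorphD /=; rewrite rmorphD /= in a2; lra.
lia.
Qed.

Lemma floor_same (u v : R) : Num.floor u = Num.floor v -> `|u - v| <= 1.
Proof.
move=> E; have [a1 a2] := (floor_le u, floorD1_gt u).
have [b1 b2] := (floor_le v, floorD1_gt v).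
rewrite E rmorphD /= in a1 a2; rewrite rmorphD /= in b2.
by rewrite ler_norml; apply/andP; split; lra.
Qed.

End DyadicCubes.

(** * The product inequality *)

Section Product.
Context {R : realType}.

(** The integer coordinates of the dyadic cube of side 2^-j that contains x. *)
Let fl n (j : nat) (x : 'rV[R]_n) (l : 'I_n) : int := Num.floor ((2 ^ j)%:R * x 0 l).

(** Points at distance at most 2^-j lie in the same or adjacent cubes, which the
   residues modulo 3 of the coordinates tell apart. *)
Let color n j (x : 'rV[R]_n) : {ffun 'I_n -> 'I_3} :=
  [ffun l => inord `|(fl j x l %% 3)%Z|%N].

Let fl_color n j (x y : 'rV[R]_n) : color j x = color j y ->
  (forall l, `|x 0 l - y 0 l| <= 2^-1 ^+ j) -> forall l, fl j x l = fl j y l.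
Proof.
move=> /ffunP cxy xy l; have := cxy l; rewrite !ffunE => /(congr1 val) /=.
have mod3 (z : int) : (`|(z %% 3)%Z| < 3)%N by lia.
rewrite !inordK ?mod3 //.
have : `|fl j x l - fl j y l| <= 1.
  apply: floor_close; rewrite -mulrBr normrM ger0_norm // natrX.
  have := xy l; rewrite exprVn -ler_pdivlMl ?exprn_gt0 // mulr1.
  by [].
lia.
Qed.

Let fl_coarse n j j' (x y : 'rV[R]_n) : (j <= j')%N ->
  (forall l, fl j' x l = fl j' y l) -> forall l, fl j x l = fl j y l.
Proof.
move=> jj xy l; apply: (@floor_scale _ (2 ^ (j' - j))); first by rewrite expn_gt0.
by rewrite !mulrA -!natrM -expnD subnK //; exact: xy.
Qed.

Let fl_diam n j (x y : 'rV[R]_n) : (forall l, fl j x l = fl j y l) ->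
  eucl_dist x y <= n.+1%:R * 2^-1 ^+ j.
Proof.
move=> xy; apply: (@le_trans _ _ (n%:R * 2^-1 ^+ j)); last first.
  by rewrite ler_wpM2r ?exprn_ge0 // ler_nat.
apply: eucl_dist_le => [|l]; first by rewrite exprn_ge0.
have := floor_same (xy l); rewrite -mulrBr normrM ger0_norm // natrX exprVn.
by rewrite -ler_pdivlMl ?exprn_gt0 // mulr1.
Qed.

(** The set G need only map onto A x B by a 1-Lipschitz map, which spares a
    metric on products. The sets U_i are not dyadic cubes, but each is a union
    of at most 3^n pieces of such cubes, one for each colour b. A point of A
    covered c times by the U_i is covered c/3^n times by the cubes C b i of some
    colour b, and thinning is applied to each colour separately. *)
Lemma null_product {T T2 : Type} (d : T -> T -> R) (d2 : T2 -> T2 -> R) n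
    (A : set 'rV[R]_n) (B : set T2) (G : set T) (f : T -> 'rV[R]_n) (g : T -> T2) s t :
  0 < s -> 0 < t ->
  (forall x y l, `|f x 0 l - f y 0 l| <= d x y) ->
  (forall x y, d2 (g x) (g y) <= d x y) ->
  (forall a b, A a -> B b -> exists x, [/\ G x, f x = a & g x = b]) ->
  null d (s + t) G -> null eucl_dist s A \/ null d2 t B.
Proof.
move=> s0 t0 fd gd GAB nG; have [|nB] := pselect (null d2 t B); [by right|left].
move=> e e0.
have [c [c0 nBc]] : exists c, 0 < c /\ ~ covered d2 t c B.
  by apply: contrapT => /forallNP H; apply: nB => c c0; apply: contrapT => h; apply: (H c).
pose F : finType := {ffun 'I_n -> 'I_3}.
pose N : R := #|F|.+1%:R; have N0 : 0 < N by [].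
pose kap := c / N; pose K := e / N.
have kap0 : 0 < kap by rewrite divr_gt0.
have K0 : 0 < K by rewrite divr_gt0.
pose L : R := n.+1%:R; have Ls0 : 0 < L `^ s by rewrite powR_gt0.
pose eta := kap * K / 2 / L `^ s; have eta0 : 0 < eta by rewrite !divr_gt0 // mulr_gt0.
have [V [j [GV Vd Vs]]] := null_dyadic (addr_gt0 s0 t0) eta0 nG.
pose rho i : R := 2^-1 ^+ j i; have rho0 i : 0 < rho i by rewrite exprn_gt0.
pose w i := rho i `^ t; pose g' i := (L * rho i) `^ s.
have w0 i : 0 <= w i by exact: powR_ge0.
have g0 i : 0 <= g' i by exact: powR_ge0.
pose U i := [set a | exists x, V i x /\ f x = a].
have Uclose i x y l : U i x -> U i y -> `|x 0 l - y 0 l| <= rho i.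
  by move=> [u [Vu <-]] [v [Vv <-]]; apply: le_trans (fd _ _ _) (Vd _ _ _ Vu Vv).
(* The dyadic cube that contains the part of U i of colour b, or the empty set
   when there is no such part. *)
pose C b i := [set y | exists x, [/\ U i x, color (j i) x = b & forall l, fl (j i) y l = fl (j i) x l]].
have Cfl b i x y : C b i x -> C b i y -> forall l, fl (j i) x l = fl (j i) y l.
  move=> [x' [Ux' cx' xx']] [y' [Uy' cy' yy']] l; rewrite xx' yy'; apply: fl_color.
    by rewrite cx' cy'.
  by move=> l'; apply: Uclose.
have nested b i i' : (j i <= j i')%N -> C b i `&` C b i' !=set0 -> C b i' `<=` C b i.
  move=> ij [z [Cz C'z]] y C'y; have [x [Ux cx zx]] := Cz.
  exists x; split => // l; rewrite -zx; apply: (fl_coarse ij) => l'.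
  exact: Cfl C'y C'z l'.
have sumwg : (\sum_(i <oo) (w i * g' i)%:E < (kap * K)%:E)%E.
  apply: (@le_lt_trans _ _ ((L `^ s)%:E * eta%:E)%E); last first.
    rewrite -EFinM lte_fin /eta mulrC divfK ?gt_eqF //.
    by have := mulr_gt0 kap0 K0; lra.
  have -> : (\sum_(i <oo) (w i * g' i)%:E = \sum_(i <oo) (L `^ s)%:E * ((rho i `^ (s + t))%:E))%E.
    apply: eq_eseriesr => i _; rewrite -EFinM; congr EFin.
    rewrite /w /g' powRM ?ltW // powRD; last by rewrite gt_eqF ?addr_gt0.
    by ring.
  rewrite nneseriesZl; last by move=> i _; rewrite lee_fin powR_ge0.
  by apply: lee_wpmul2l => //; rewrite lee_fin ltW.
pose Ab b := [set x | A x /\ (kap%:E <= \sum_(i <oo | `[< C b i x >]) (w i)%:E)%E].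
(* If no colour were heavy at x, the slices over x would be a cover of B of cost
   at most c. *)
have AAb : A `<=` \bigcup_b Ab b.
  move=> x Ax; apply: contrapT => H; apply: nBc.
  have Hb b : (\sum_(i <oo | `[< C b i x >]) (w i)%:E <= kap%:E)%E.
    by rewrite leNgt; apply/negP => h; apply: H; exists b => //; split => //; exact: ltW.
  exists (fun i => [set b | exists z, [/\ V i z, f z = x & g z = b]]),
    (fun i => if `[< U i x >] then rho i else 0); split.
  - move=> b Bb; have [z [Gz fz gz]] := GAB _ _ Ax Bb.
    by have [i _ Vz] := GV _ Gz; exists i => //; exists z.
  - by move=> i; case: ifP => // _; exact: ltW.
  - move=> i b b' [z [Vz fz <-]] [z' [Vz' fz' <-]].
    rewrite asboolT; last by exists z.
    exact: le_trans (gd _ _) (Vd _ _ _ Vz Vz').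
  apply: (@le_trans _ _ (\sum_(i <oo) \sum_(b : F) if `[< C b i x >] then (w i)%:E else 0)%E).
    apply: lee_nneseries => [i _ _|i _]; first by rewrite lee_fin powR_ge0.
    have term0 b : (0 <= if `[< C b i x >] then (w i)%:E else 0)%E.
      by case: ifP => // _; rewrite lee_fin.
    case: asboolP => [Ux|_]; last by rewrite powR0 ?gt_eqF // sume_ge0.
    rewrite (bigD1 (color (j i) x)) //= asboolT; last by exists x.
    by rewrite leeDl // sume_ge0.
  rewrite nneseries_sum; last by move=> b i _; case: ifP => // _; rewrite lee_fin.
  apply: (@le_trans _ _ (\sum_(b : F) kap%:E)%E).
    by apply: lee_sum => b _; rewrite -eseries_mkcond.
  rewrite sumEFin lee_fin sumr_const -mulr_natl /kap mulrCA ger_pMr //.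
  by rewrite ler_pdivrMr // mul1r ler_nat.
have cAb b : covered eucl_dist s K (Ab b).
  have [I [AI sI]] := @weighted_thinning R _ (Ab b) (C b) j w g' w0 g0 (nested b) kap K kap0
    (fun x h => h.2) sumwg.
  exists (fun i => if I i then C b i else set0), (fun i => if I i then L * rho i else 0); split.
  - by move=> x /AI[i /= Ii Cx]; exists i => //; rewrite Ii.
  - by move=> i; case: ifP => // _; rewrite mulr_ge0 // ltW.
  - by move=> i x y; case: ifP => // _ Cx Cy; apply: fl_diam; exact: Cfl Cx Cy.
  rewrite (le_trans _ sI) // [leRHS]eseries_mkcond; apply: lee_nneseries => [i _ _|i _].
    by rewrite lee_fin powR_ge0.
  by case: ifP => // _; rewrite powR0 ?gt_eqF.
apply: (covered_mono AAb _ (covered_fin s0 cAb)).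
by rewrite /K mulrCA ger_pMr // ler_pdivrMr // mul1r ler_nat.
Qed.

End Product.

(** * Bundles of cubes *)

Section CubeBundle.
Context {R : realType}.

Lemma covered_one {T : Type} (d : T -> T -> R) (t r : R) (A : set T) :
  0 < t -> 0 <= r -> (forall x y, A x -> A y -> d x y <= r) ->
  covered d t (r `^ t) A.
Proof.
move=> t0 r0 rA; apply: (@covered_countable _ _ _ unit (fun=> A) (fun=> r)) => //.
  by move=> x Ax; exists tt.
have -> : [set: unit] = [set tt] by apply/seteqP; split => // -[].
by rewrite esum_set1 // lee_fin powR_ge0.
Qed.

(** A set of radius r = 2^-j costs r^t; its product with the cube splits along a
    grid of mesh r into a constant times r^-p pieces of radius comparable to r,
    each of cost a constant times r^(t+p). *)
Lemma null_cube_bundle (T1 T : Type) (d1 : T1 -> T1 -> R) (d : T -> T -> R)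
    (A : set T1) p (N : nat) (phi : T1 -> 'rV[R]_p -> T) (L t : R) :
  0 < t -> 0 <= L ->
  (forall a a' (v v' : 'rV[R]_p) (r : R), A a -> A a' ->
    (forall l, `|v 0 l| <= N%:R) -> (forall l, `|v' 0 l| <= N%:R) ->
    0 <= r -> d1 a a' <= r -> (forall l, `|v 0 l - v' 0 l| <= r) ->
    d (phi a v) (phi a' v') <= L * r) ->
  null d1 t A ->
  null d (t + p%:R) [set x | exists a (v : 'rV[R]_p), [/\ A a, forall l, `|v 0 l| <= N%:R & x = phi a v]].
Proof.
move=> t0 L0 lip nA e e0.
have tp0 : 0 < t + p%:R by rewrite ltr_wpDr.
pose C : R := (2 * N + 1)%:R ^+ p * L `^ (t + p%:R) + 1.
have C0 : 0 < C by rewrite ltr_wpDl // mulr_ge0 ?exprn_ge0 ?powR_ge0.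
have [U [j [AU Ud Us]]] := null_dyadic t0 (divr_gt0 e0 C0) nA.
pose rho i : R := 2^-1 ^+ j i; have rho0 i : 0 < rho i by rewrite exprn_gt0.
pose M i := (N * 2 ^ j i)%N.
pose F i : finType := {ffun 'I_p -> 'I_(2 * M i).+1}.
pose cell i (v : 'rV[R]_p) : F i :=
  [ffun l => inord (absz (Num.floor ((2 ^ j i)%:R * v 0 l) + (M i)%:Z))].
have cellP i (v v' : 'rV[R]_p) : (forall l, `|v 0 l| <= N%:R) -> (forall l, `|v' 0 l| <= N%:R) ->
    cell i v = cell i v' -> forall l, `|v 0 l - v' 0 l| <= rho i.
  have bnd (u : 'rV[R]_p) : (forall l, `|u 0 l| <= N%:R) -> forall l,
      - (M i)%:Z <= Num.floor ((2 ^ j i)%:R * u 0 l) <= (M i)%:Z.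
    move=> uN l; have := uN l; rewrite ler_norml => /andP[h1 h2].
    have p0 : (0 : R) < (2 ^ j i)%:R by rewrite ltr0n expn_gt0.
    apply/andP; split.
      rewrite floor_ge_int rmorphN /= -pmulrn /M natrM mulrC -mulrN.
      by rewrite ler_pM2l.
    rewrite -(ler_int R); apply: le_trans (floor_le _) _.
    by rewrite -pmulrn /M natrM mulrC ler_pM2r.
  move=> vN v'N /ffunP cc l; have := cc l; rewrite !ffunE => /(congr1 val) /=.
  have /andP[h1 h2] := bnd v vN l; have /andP[h3 h4] := bnd v' v'N l.
  rewrite !inordK; [|lia|lia] => E.
  have /floor_same : Num.floor ((2 ^ j i)%:R * v 0 l) = Num.floor ((2 ^ j i)%:R * v' 0 l) by lia.
  rewrite -mulrBr normrM ger0_norm // natrX /rho exprVn.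
  by rewrite -ler_pdivlMl ?exprn_gt0 // mulr1.
pose S i c := [set x | exists a (v : 'rV[R]_p), [/\ A a /\ U i a, forall l, `|v 0 l| <= N%:R,
  cell i v = c & x = phi a v]].
have cS i c : covered d (t + p%:R) ((L * rho i) `^ (t + p%:R)) (S i c).
  apply: covered_one => //; first by rewrite mulr_ge0 // ltW.
  move=> _ _ [a [v [[Aa Ua] vN cv ->]]] [a' [v' [[Aa' Ua'] v'N cv' ->]]].
  apply: lip => //; [exact: ltW|exact: Ud|].
  by apply: cellP => //; rewrite cv cv'.
have cSi i := covered_fin tp0 (cS i).
apply: (@covered_mono _ _ _ _ _ e _ (\bigcup_i \bigcup_c S i c)) => //.
  move=> _ [a [v [Aa vN ->]]]; have [i _ Ua] := AU _ Aa.
  by exists i => //; exists (cell i v) => //; exists a, v.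
apply: (covered_bigcup tp0 cSi).
apply: (@le_trans _ _ (\sum_(i <oo) C%:E * (rho i `^ t)%:E)%E); last first.
  rewrite nneseriesZl; last by move=> i _; rewrite lee_fin powR_ge0.
  apply: le_trans (lee_wpmul2l _ Us) _; first by rewrite lee_fin ltW.
  by rewrite -EFinM mulrC divfK // gt_eqF.
apply: lee_nneseries => [i _ _|i _]; first by rewrite lee_fin mulr_ge0 ?powR_ge0.
rewrite -EFinM lee_fin /F card_ffun !card_ord.
rewrite powRM ?(ltW (rho0 i)) // [X in _ * (_ * X)]powRD; last first.
  by apply/implyP => _; rewrite gt_eqF.
rewrite (powR_mulrn _ (ltW (rho0 i))).
have cardM : ((2 * M i).+1 ^ p)%:R * rho i ^+ p <= (2 * N + 1)%:R ^+ p :> R.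
  rewrite natrX -exprMn; apply: lerXn2r; rewrite ?nnegrE ?mulr_ge0 ?(ltW (rho0 i)) //.
  rewrite /rho exprVn ler_pdivrMr ?exprn_gt0 // -natrX -natrM ler_nat /M.
  by rewrite mulnDl mul1n mulnA -addn1 leq_add2l expn_gt0.
have A1 : 0 <= L `^ (t + p%:R) by exact: powR_ge0.
have A2 : 0 <= rho i `^ t by exact: powR_ge0.
rewrite /C mulrDl mul1r; apply: ler_wpDr => //.
rewrite [leLHS](_ : _ = (((2 * M i).+1 ^ p)%:R * rho i ^+ p) * (L `^ (t + p%:R) * rho i `^ t)); last by ring.
by rewrite -[leRHS]mulrA; apply: ler_wpM2r => //; rewrite mulr_ge0.
Qed.

End CubeBundle.

(** * Dimension of the set of tuples *)

Section Tuples.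
Context {R : realType}.

(** Euclidean space and the bundles below are exhausted by countably many cubes. *)
Let bounded n (v : 'rV[R]_n) : exists N : nat, forall l, `|v 0 l| <= N%:R.
Proof.
exists (Num.bound (\sum_l `|v 0 l|)) => l.
have s0 : 0 <= \sum_l `|v 0 l| by apply: sumr_ge0.
apply: le_trans (ltW (archi_boundP s0)).
by rewrite (bigD1 l) //= lerDl; apply: sumr_ge0.
Qed.

(** Any exponent above n would do; with 1 + n, the space is a bundle of cubes
    over a point, which is 1-null. *)
Lemma null_full n (A : set 'rV[R]_n) : null eucl_dist (1 + n%:R) A.
Proof.
have t0 : 0 < 1 + n%:R :> R by rewrite ltr_wpDr.
apply: (@null_sub _ _ _ _ _ (\bigcup_(N : nat) [set x | exists (a : unit) (v : 'rV[R]_n),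
    [/\ True, forall l, `|v 0 l| <= N%:R & x = v]])).
  by move=> x _; have [N xN] := bounded x; exists N => //; exists tt, x.
apply: null_bigcup => // N.
apply: (@null_cube_bundle _ _ _ (fun _ _ => 0) eucl_dist setT n N (fun _ v => v) n%:R) => //.
  by move=> *; apply: eucl_dist_le.
move=> e e0; apply: (@covered_mono _ _ _ _ _ (0 `^ 1) _ setT) => //.
  by rewrite powR0 ?oner_eq0 // ltW.
exact: covered_one.
Qed.

Lemma hdim_lty n (A : set 'rV[R]_n) : (hdim eucl_dist A < +oo)%E.
Proof.
apply: le_lt_trans (hdim_le (@eucl_dist_ge0 _ _) _ (null_full A)) (ltry _).
by rewrite ltr_wpDr.
Qed.

Variables (d : nat) (E : set 'rV[R]_d).

Let others k (i : 'I_k.+1) (w : 'rV[R]_(k.+1 * d)) : 'rV[R]_(k * d) :=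
  mxvec (row' i (vec_mx w)).

Lemma mxvec_close m n (M M' : 'M[R]_(m, n)) r c :
  (forall i l, `|M i l - M' i l| <= r) ->
  `|mxvec M 0 c - mxvec M' 0 c| <= r.
Proof. by move=> H; case/mxvec_indexP: c => i l; rewrite !mxvecE. Qed.

Let othersP k (i : 'I_k.+1) w : tuple_pow k.+1 E w -> tuple_pow k E (others i w).
Proof.
move=> H j; rewrite /others mxvecK; have := H (lift i j).
by congr (E _); apply/rowP => l; rewrite !mxE.
Qed.

Lemma null_tuple_pow k s t : 0 < s -> 0 < t ->
  null eucl_dist (s + t) (tuple_pow k.+1 E) ->
  null eucl_dist s E \/ null eucl_dist t (tuple_pow k E).
Proof.
(* The distance is rescaled so that forgetting the first point becomes
   1-Lipschitz. *)
move=> s0 t0 nE; pose c : R := (k * d).+1%:R.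
have c1 : 1 <= c by rewrite ler1n.
have nE' : null (fun w w' => c * eucl_dist w w') (s + t) (tuple_pow k.+1 E).
  apply: (null_lipschitz (rho := eq) (L := c) _ _ _ _ nE); rewrite ?addr_gt0 //.
  - by move=> y Ey; exists y.
  - by move=> x y x' y' -> ->.
apply: (@null_product _ _ _ (fun w w' : 'rV[R]_(k.+1 * d) => c * eucl_dist w w') eucl_dist d E
   (tuple_pow k E) _ (fun w => row 0 (vec_mx w)) (others 0) s t s0 t0 _ _ _ nE').
- move=> x y l; apply: (@le_trans _ _ (eucl_dist x y)); last by rewrite ler_peMl // eucl_dist_ge0.
  by rewrite !mxE eucl_dist_coord.
- move=> x y; apply: (@le_trans _ _ ((k * d)%:R * eucl_dist x y)); last first.
    by rewrite ler_wpM2r ?eucl_dist_ge0 // ler_nat.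
  apply: eucl_dist_le => [|l]; first exact: eucl_dist_ge0.
  by apply: mxvec_close => i j; rewrite !mxE eucl_dist_coord.
move=> a b Ea Eb.
pose X : 'M[R]_(k.+1, d) := \matrix_i (if unlift 0 i is Some j then row j (vec_mx b) else a).
exists (mxvec X); split.
- move=> i; rewrite mxvecK rowK; case: unliftP => // j _; exact: Eb.
- by rewrite mxvecK rowK unlift_none.
- rewrite /others mxvecK -[RHS]vec_mxK; congr mxvec; apply/row_matrixP => i.
  have -> : row i (row' 0 X) = row (lift 0 i) X by apply/rowP => l; rewrite !mxE.
  by rewrite rowK liftK.
Qed.

Lemma tuple_pow_not_null k s : 0 < s -> ~ null eucl_dist s E ->
  ~ null eucl_dist (k.+1%:R * s) (tuple_pow k.+1 E).
Proof.
move=> s0 nE; elim: k => [|k IH].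
  rewrite mul1r => n1; apply: nE.
  apply: (null_lipschitz (rho := fun w x => x = row 0 (vec_mx w)) (L := d.+1%:R) s0 _ _ _ n1) => //.
    move=> y Ey; exists (mxvec (\matrix_(i < 1) y)); last by rewrite mxvecK rowK.
    by move=> i; rewrite mxvecK rowK.
  move=> x y x' y' -> ->; apply: (@le_trans _ _ (d%:R * eucl_dist x x')); last first.
    by rewrite ler_wpM2r ?eucl_dist_ge0 // ler_nat.
  apply: eucl_dist_le => [|l]; first exact: eucl_dist_ge0.
  by rewrite !mxE eucl_dist_coord.
rewrite -natr1 mulrDl mul1r addrC => /null_tuple_pow -[]//.
by rewrite mulr_gt0.
Qed.

(** Inverse to forgetting the point of index i, when this point is the linear
   combination of the others with coefficients v. *)
Let insert k (i : 'I_k.+1) (y : 'rV[R]_(k * d)) (v : 'rV[R]_k) : 'rV[R]_(k.+1 * d) :=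
  mxvec (\matrix_j (if unlift i j is Some j' then row j' (vec_mx y) else v *m vec_mx y)).

Let insert_others k (i : 'I_k.+1) (x : 'rV[R]_(k.+1 * d)) (l : 'rV[R]_k.+1) :
  l 0 i != 0 -> l *m vec_mx x = 0 ->
  x = insert i (others i x) (\row_j (- l 0 (lift i j) / l 0 i)).
Proof.
move=> li lx; rewrite -[LHS]vec_mxK /insert /others; congr mxvec.
apply/row_matrixP => j; rewrite rowK mxvecK; case: unliftP => [j' ->|->].
  by apply/rowP => c; rewrite !mxE.
apply/rowP => c; rewrite !mxE.
have /rowP/(_ c) := lx; rewrite !mxE (bigD1_ord i) //= => /eqP.
rewrite addr_eq0 => /eqP H; apply: (mulfI li).
rewrite mulr_sumr; transitivity (- \sum_(j < k) l 0 (lift i j) * vec_mx x (lift i j) c).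
  by rewrite -H mxE.
rewrite -sumrN; apply: eq_bigr => j' _; rewrite !mxE; field.
by [].
Qed.

(** A dependent tuple is determined by k of its points and by k coefficients, so
    the dependent tuples of E form a countable union of Lipschitz bundles of
    k-dimensional cubes over bounded parts of E^k. *)
Lemma null_dependent k t : 0 < t -> null eucl_dist t (tuple_pow k E) ->
  null eucl_dist (t + k%:R) (tuple_pow k.+1 E `&` [set x | affinely_dependent x]).
Proof.
move=> t0 nEk; have tk0 : 0 < t + k%:R by rewrite ltr_wpDr.
pose S (i : 'I_k.+1) (N : nat) := [set x | exists y (v : 'rV[R]_k),
  [/\ tuple_pow k E y /\ (forall l, `|y 0 l| <= N%:R), forall l, `|v 0 l| <= N%:R &
     x = insert i y v]].
apply: (@null_sub _ _ _ _ _ (\bigcup_i \bigcup_N S i N)).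
  move=> x [Ex [l [l0 _ lx]]].
  have [i li] : exists i, l 0 i != 0.
    apply: contrapT => /forallNP H; move/eqP: l0; apply; apply/rowP => i.
    by rewrite mxE; apply/eqP/negPn/negP/H.
  pose v : 'rV[R]_k := \row_j (- l 0 (lift i j) / l 0 i).
  have [N1 H1] := bounded (others i x); have [N2 H2] := bounded v.
  exists i => //; exists (maxn N1 N2) => //; exists (others i x), v; split.
  - split=> [|c]; first exact: othersP.
    by apply: le_trans (H1 c) _; rewrite ler_nat leq_maxl.
  - by move=> c; apply: le_trans (H2 c) _; rewrite ler_nat leq_maxr.
  - exact: insert_others.
apply: null_fin => // i; apply: null_bigcup => // N.
pose L : R := 1 + k%:R * (2 * N%:R).
have L1 : 0 <= L by rewrite addr_ge0 // !mulr_ge0.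
apply: (@null_cube_bundle _ _ _ eucl_dist eucl_dist
  (tuple_pow k E `&` [set y | forall l, `|y 0 l| <= N%:R]) k N (insert i)
  ((k.+1 * d)%:R * L)) => //.
- by rewrite mulr_ge0.
- move=> y y' v v' r [_ yN] [_ y'N] vN v'N r0 yr vr; rewrite -mulrA.
  apply: eucl_dist_le => [|c]; first by rewrite mulr_ge0.
  have yyr c' : `|y 0 c' - y' 0 c'| <= r by apply: le_trans (eucl_dist_coord _ _ _) yr.
  apply: mxvec_close => j l; rewrite !mxE; case: unliftP => [j' _|_].
    rewrite !mxE; apply: le_trans (yyr _) _; rewrite ler_peMl //.
    by rewrite lerDl !mulr_ge0.
  rewrite !mxE -sumrB; apply: le_trans (ler_norm_sum _ _ _) _.
  apply: (@le_trans _ _ (\sum_(c < k) (2 * N%:R * r))).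
    apply: ler_sum => a _; rewrite !mxE.
    set p := y 0 _; set p' := y' 0 _.
    have -> : v 0 a * p - v' 0 a * p' = (v 0 a - v' 0 a) * p + v' 0 a * (p - p') by ring.
    apply: le_trans (ler_normD _ _) _; rewrite !normrM.
    rewrite [leRHS](_ : _ = r * N%:R + N%:R * r); last by ring.
    by apply: lerD; apply: ler_pM => //; [exact: yN|exact: yyr].
  rewrite sumr_const card_ord [leLHS](_ : _ = k%:R * (2 * N%:R) * r).
    by rewrite /L [leRHS]mulrDl mul1r lerDr.
  by rewrite -[LHS]mulr_natl; ring.
by apply: null_sub nEk => y [].
Qed.

(** Suppose that E^(k+1) is not u-null, while its independent tuples are. Then
    its dependent tuples are not u-null, so that E^k is not (u-k)-null by
    [null_dependent], and E^(k+1) is not (u+s-k)-null by [null_tuple_pow].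
    Iterating, u grows beyond any bound, against [null_full]. The iteration
    starts at an exponent u0 > k, as [null_dependent] requires. *)
Lemma null_indep_tuples k s t : k%:R < s -> 0 < t -> ~ null eucl_dist s E ->
  null eucl_dist t (indep_tuples k E) -> null eucl_dist t (tuple_pow k.+1 E).
Proof.
move=> ks t0 nE nI; apply: contrapT => nT.
have s0 : 0 < s by apply: le_lt_trans ks.
pose u0 := Num.max t (k.+1%:R * s).
have u0t : t <= u0 by rewrite le_max lexx.
have u0k : k%:R < u0.
  rewrite lt_max; apply/orP; right; apply: lt_le_trans ks _.
  by rewrite ler_peMl ?ler1n // ltW.
have nu0 : ~ null eucl_dist u0 (tuple_pow k.+1 E).
  by rewrite /u0 maxEle; case: ifP => // _; exact: tuple_pow_not_null.
have step m : ~ null eucl_dist (u0 + m%:R * (s - k%:R)) (tuple_pow k.+1 E).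
  elim: m => [|m IH]; first by rewrite mul0r addr0.
  set u := u0 + m%:R * (s - k%:R) in IH.
  have uu : u0 <= u by rewrite lerDl mulr_ge0 // subr_ge0 ltW.
  have uk : 0 < u - k%:R by rewrite subr_gt0 (lt_le_trans u0k).
  have -> : u0 + m.+1%:R * (s - k%:R) = s + (u - k%:R) by rewrite /u -natr1; ring.
  move=> /(null_tuple_pow s0 uk) [//|/(null_dependent uk)]; rewrite subrK => nD.
  apply: IH; apply: (@null_sub _ _ _ _ _ (indep_tuples k E `|`
     (tuple_pow k.+1 E `&` [set x | affinely_dependent x]))).
    by move=> x Ex; have [?|?] := pselect (affinely_dependent x); [right|left].
  apply: nullU => //; first by apply: lt_le_trans t0 (le_trans u0t uu).
  by apply: null_le nI => //; exact: le_trans uu.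
have sk0 : 0 < s - k%:R by rewrite subr_gt0.
pose n := (k.+1 * d)%N.
have [m mP] : exists m : nat, (1 + n%:R) / (s - k%:R) <= m%:R.
  exists (Num.bound ((1 + n%:R) / (s - k%:R))); apply/ltW/archi_boundP.
  by apply: divr_ge0; [rewrite addr_ge0|exact: ltW].
apply: (step m); apply: null_le (null_full _); first by rewrite ltr_wpDr.
rewrite ler_pdivrMr // in mP; apply: le_trans mP _.
by rewrite lerDr (le_trans _ u0t) // ltW.
Qed.

End Tuples.

(** * Coordinates on the affine Grassmannian *)

Section Grassmannian.
Context {R : realType}.

Lemma enorm0 n : enorm (0 : 'rV[R]_n) = 0.
Proof. by rewrite /enorm big1 ?sqrtr0 // => i _; rewrite mxE expr0n. Qed.

Lemma enorm_mul_le n (v : 'rV[R]_n) (M : 'M[R]_n) c : 0 <= c ->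
  (forall i j, `|M i j| <= c) -> enorm v <= 1 -> enorm (v *m M) <= n%:R * (n%:R * c).
Proof.
move=> c0 Mc v1; apply: enorm_le => [|l]; first by rewrite mulr_ge0.
rewrite mxE; apply: le_trans (ler_norm_sum _ _ _) _.
apply: (@le_trans _ _ (\sum_(i < n) c)); last by rewrite sumr_const card_ord -[leLHS]mulr_natl.
apply: ler_sum => i _; rewrite normrM -[leRHS]mul1r; apply: ler_pM => //.
exact: le_trans (enorm_coord v i) v1.
Qed.

Lemma opnorm_le n (M : 'M[R]_n) c : 0 <= c -> (forall i j, `|M i j| <= c) ->
  opnorm M <= n%:R * (n%:R * c).
Proof.
move=> c0 Mc; apply: ge_sup; last by move=> _ [v v1 <-]; exact: enorm_mul_le.
by exists (enorm ((0 : 'rV[R]_n) *m M)), 0 => //=; rewrite enorm0.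
Qed.

(** The operator norm dominates every entry, through the image of a unit vector.
    That the supremum is bounded has to be checked, since [sup] of an unbounded
    set is 0. *)
Lemma opnorm_entry n (M : 'M[R]_n) i j : `|M i j| <= opnorm M.
Proof.
apply: (@le_trans _ _ (enorm (delta_mx 0 i *m M))).
  by apply: le_trans (enorm_coord _ j); rewrite -rowE mxE.
apply: ub_le_sup; last first.
  exists (delta_mx 0 i) => //=; rewrite /enorm (bigD1 i) //= mxE !eqxx expr1n big1 ?addr0 ?sqrtr1 //.
  by move=> l li; rewrite mxE (negPf li) andbF expr0n.
pose c := \sum_i \sum_j `|M i j|.
have c0 : 0 <= c by apply: sumr_ge0 => a _; apply: sumr_ge0.
exists (n%:R * (n%:R * c)) => _ [v v1 <-]; apply: enorm_mul_le => // a b.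
rewrite /c (bigD1 a) //= (bigD1 b) //= -addrA lerDl addr_ge0 //.
  exact: sumr_ge0.
by apply: sumr_ge0 => ? _; apply: sumr_ge0.
Qed.

Lemma opnorm_ge0 n (M : 'M[R]_n) : 0 <= opnorm M.
Proof.
case: n M => [M|n M]; last by apply: le_trans (opnorm_entry M 0 0).
rewrite /opnorm; set A := [set _ | _ in _].
suff -> : A = [set 0] by rewrite sup1.
have e0 (u : 'rV[R]_0) : enorm u = 0 by rewrite /enorm big_ord0 sqrtr0.
apply/seteqP; split => [_ [v _ <-]|_ ->] /=; first exact: e0.
by exists 0; [rewrite /= e0|exact: e0].
Qed.

Lemma Gr_dist_ge0 n (W V : set 'rV[R]_n) : 0 <= Gr_dist W V.
Proof. by rewrite addr_ge0 ?opnorm_ge0 ?sqrtr_ge0. Qed.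

Lemma Gr_dist_dirproj n (W V : set 'rV[R]_n) i j :
  `|dirproj W i j - dirproj V i j| <= Gr_dist W V.
Proof.
apply: ler_wpDr; first exact: sqrtr_ge0.
by apply: le_trans (opnorm_entry _ i j); rewrite !mxE.
Qed.

Lemma Gr_dist_offset n (W V : set 'rV[R]_n) l :
  `|offset W 0 l - offset V 0 l| <= Gr_dist W V.
Proof.
apply: ler_wpDl; first exact: opnorm_ge0.
by apply: le_trans (enorm_coord _ l); rewrite !mxE.
Qed.

Lemma Gr_dist_le n (W V : set 'rV[R]_n) r : 0 <= r ->
  (forall i j, `|dirproj W i j - dirproj V i j| <= r) ->
  (forall l, `|offset W 0 l - offset V 0 l| <= r) ->
  Gr_dist W V <= (n * n + n)%:R * r.
Proof.
move=> r0 H1 H2; rewrite natrD natrM mulrDl -mulrA; apply: lerD.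
  by apply: opnorm_le => // i j; rewrite [X in `|X|]mxE [X in _ + X]mxE; exact: H1.
by apply: enorm_le => // l; rewrite [X in `|X|]mxE [X in _ + X]mxE; exact: H2.
Qed.

Lemma Gr_coord_le n (W V : set 'rV[R]_n) r : 0 <= r ->
  (forall i j, `|dirproj W i j - dirproj V i j| <= r) ->
  (forall l, `|offset W 0 l - offset V 0 l| <= r) ->
  eucl_dist (Gr_coord W) (Gr_coord V) <= (n * n + n)%:R * r.
Proof.
move=> r0 H1 H2; apply: eucl_dist_le => // c; rewrite /Gr_coord.
case: (split_ordP c) => i ->; last by rewrite !row_mxEr.
by rewrite !row_mxEl; apply: mxvec_close.
Qed.

Lemma Gr_coord_dirproj n (W V : set 'rV[R]_n) i j :
  `|dirproj W i j - dirproj V i j| <= eucl_dist (Gr_coord W) (Gr_coord V).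
Proof.
apply: le_trans (eucl_dist_coord _ _ (lshift n (mxvec_index i j))).
by rewrite /Gr_coord !row_mxEl !mxvecE.
Qed.

Lemma Gr_coord_offset n (W V : set 'rV[R]_n) l :
  `|offset W 0 l - offset V 0 l| <= eucl_dist (Gr_coord W) (Gr_coord V).
Proof.
apply: le_trans (eucl_dist_coord _ _ (rshift (n * n) l)).
by rewrite /Gr_coord !row_mxEr.
Qed.

Lemma affine_Gr_memE n k (W : set 'rV[R]_n) : affine_Gr n k W ->
  W = [set x | (x - offset W) *m dirproj W = x - offset W].
Proof.
move=> /normal_formP[_ E]; rewrite {1}E /dirproj /offset; apply/seteqP; split => x /=.
  exact: orthoproj_id.
by rewrite /flat /= => <-; exact: orthoproj_sub.
Qed.

Lemma Gr_coord_inj n k (W V : set 'rV[R]_n) : affine_Gr n k W -> affine_Gr n k V ->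
  Gr_coord W = Gr_coord V -> W = V.
Proof.
move=> GW GV /eq_row_mx [/(can_inj (@mxvecK _ _ _)) eD eO].
by rewrite (affine_Gr_memE GW) (affine_Gr_memE GV) eD eO.
Qed.

Section Powers.
Variables (m n : nat).

(** The matrix that applies U to each of the m points of a tuple. *)
Let pow_mx (U : 'M[R]_n) : 'M[R]_(m * n) := lin_mx (mulmxr U : 'M[R]_(m, n) -> 'M[R]_(m, n)).

Let mul_pow_mx (A : 'M[R]_(m, n)) U : mxvec A *m pow_mx U = mxvec (A *m U).
Proof. exact: mul_vec_lin. Qed.

Let pow_mx_perp (A : 'M[R]_(m, n)) U : A *m U^T = 0 -> mxvec A *m (pow_mx U)^T = 0.
Proof.
move=> AU; apply/rowP => c; rewrite [RHS]mxE.
case/mxvec_indexP: c => i j.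
transitivity ((row i A *m U^T) 0 j); last first.
  by rewrite -row_mul AU !mxE.
rewrite [LHS]mxE [RHS]mxE (reindex _ (curry_mxvec_bij _ _)) /=.
transitivity (\sum_a \sum_b mxvec A 0 (mxvec_index a b) *
    trmx (pow_mx U) (mxvec_index a b) (mxvec_index i j)).
  by rewrite pair_bigA; apply: eq_bigr => -[a b] _.
have powE a b : pow_mx U (mxvec_index i j) (mxvec_index a b) = (a == i)%:R * U j b.
  rewrite mxE /= vec_mx_delta mxvecE mxE (bigD1 j) //= big1 ?addr0; last first.
    by move=> l lj; rewrite !mxE (negPf lj) andbF mul0r.
  by rewrite mxE eqxx andbT.
rewrite (bigD1 i) //= [X in _ + X]big1 ?addr0; last first.
  by move=> a ai; rewrite big1 // => b _; rewrite mxE powE (negPf ai) mul0r mulr0.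
by apply: eq_bigr => b _; rewrite mxvecE [trmx _ _ _]mxE powE eqxx mul1r !mxE.
Qed.

(** The normal form of the power of W consists of the block diagonal matrix with
    blocks U and of the tuple (p, ..., p), where (U, p) is that of W. By
    uniqueness of the projection and of the offset, it does not matter that
    [normal_form] may choose another matrix. *)
Lemma tuple_pow_normal_form (W : set 'rV[R]_n) k : affine_Gr n k W ->
  dirproj (tuple_pow m W) = pow_mx (dirproj W) /\
  offset (tuple_pow m W) = mxvec (\matrix_(i < m) offset W).
Proof.
move=> GW; have := normal_formP GW; rewrite /dirproj /offset.
set U := (normal_form W).1; set p := (normal_form W).2 => -[/= pU WE].
have nf : is_normal_form (tuple_pow m W) (pow_mx U, mxvec (\matrix_(i < m) p)).
  split => /=.
    by apply: pow_mx_perp; apply/row_matrixP => i; rewrite row_mul rowK pU row0.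
  rewrite WE; apply/seteqP; split => w; rewrite /tuple_pow /flat /= => H.
    have : (vec_mx w - \matrix_(i < m) p <= U)%MS.
      by apply/row_subP => i; rewrite linearB /= rowK; exact: H.
    case/submxP => D DE; apply/submxP; exists (mxvec D).
    by rewrite mul_pow_mx -DE linearB /= vec_mxK.
  move=> i; case/submxP: H => D DE.
  have -> : row i (vec_mx w) - p = row i (vec_mx D) *m U; last exact: submxMl.
  rewrite -row_mul -[vec_mx D *m U]mxvecK -mul_pow_mx vec_mxK -DE.
  by rewrite !linearB /= mxvecK rowK.
have GV : affine_Gr (m * n) (\rank (pow_mx U)) (tuple_pow m W).
  by exists (pow_mx U), (mxvec (\matrix_(i < m) p)); case: nf.
have := normal_formP GV; case: (normal_form (tuple_pow m W)) => U' p' nf'.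
have [-> ->] := normal_form_uniq nf' nf; split => //.
apply/row_matrixP => c; rewrite !rowE; set v := delta_mx _ _.
rewrite -[v in RHS]vec_mxK mul_pow_mx; set X := vec_mx v.
have -> : v = mxvec (X - X *m orthoproj U) + mxvec (X *m orthoproj U).
  by rewrite -linearD /= subrK vec_mxK.
rewrite mulmxDl orthoproj_0 ?add0r; last first.
  by apply: pow_mx_perp; apply/row_matrixP => i; rewrite row_mul linearB /= row_mul orthoproj_compl row0.
apply: orthoproj_id.
have : (X *m orthoproj U <= U)%MS.
  by apply/row_subP => i; rewrite row_mul orthoproj_sub.
by case/submxP => D ->; rewrite -mul_pow_mx submxMl.
Qed.

Lemma dirproj_tuple_pow (W : set 'rV[R]_n) k i a j b : affine_Gr n k W ->
  dirproj (tuple_pow m W) (mxvec_index i a) (mxvec_index j b) = (j == i)%:R * dirproj W a b.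
Proof.
move=> GW; rewrite (tuple_pow_normal_form GW).1.
rewrite mxE /= vec_mx_delta mxvecE mxE (bigD1 a) //= big1 ?addr0; last first.
  by move=> l la; rewrite !mxE (negPf la) andbF mul0r.
by rewrite mxE eqxx andbT.
Qed.

Lemma offset_tuple_pow (W : set 'rV[R]_n) k i a : affine_Gr n k W ->
  offset (tuple_pow m W) 0 (mxvec_index i a) = offset W 0 a.
Proof. by move=> GW; rewrite (tuple_pow_normal_form GW).2 mxvecE mxE. Qed.

End Powers.

Lemma Gr_dist_tuple_pow_le m n k (W V : set 'rV[R]_n) :
  affine_Gr n k W -> affine_Gr n k V ->
  Gr_dist (tuple_pow m W) (tuple_pow m V) <=
    (m * n * (m * n) + m * n)%:R * eucl_dist (Gr_coord W) (Gr_coord V).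
Proof.
move=> GW GV; apply: Gr_dist_le; first exact: eucl_dist_ge0.
  move=> c e; case/mxvec_indexP: c => i a; case/mxvec_indexP: e => j b.
  rewrite (dirproj_tuple_pow _ _ _ _ GW) (dirproj_tuple_pow _ _ _ _ GV) -mulrBr.
  case: (j == i); rewrite ?mul0r ?mul1r ?Gr_coord_dirproj // normr0.
  exact: eucl_dist_ge0.
move=> c; case/mxvec_indexP: c => i a.
by rewrite (offset_tuple_pow _ _ GW) (offset_tuple_pow _ _ GV) Gr_coord_offset.
Qed.

(** The exponent is positive because the flat is read off from its first
    factor. *)
Lemma Gr_coord_tuple_pow_le m n k (W V : set 'rV[R]_n) :
  affine_Gr n k W -> affine_Gr n k V ->
  eucl_dist (Gr_coord W) (Gr_coord V) <=
    (n * n + n)%:R * Gr_dist (tuple_pow m.+1 W) (tuple_pow m.+1 V).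
Proof.
move=> GW GV; apply: Gr_coord_le; first exact: Gr_dist_ge0.
  move=> a b; apply: le_trans (Gr_dist_dirproj _ _ (mxvec_index 0 a) (mxvec_index 0 b)).
  by rewrite (dirproj_tuple_pow _ _ _ _ GW) (dirproj_tuple_pow _ _ _ _ GV) !mul1r.
move=> a; apply: le_trans (Gr_dist_offset _ _ (mxvec_index 0 a)).
by rewrite (offset_tuple_pow _ _ GW) (offset_tuple_pow _ _ GV).
Qed.

End Grassmannian.

(** * Essential suprema and the incidence set *)

Section HausdorffTransfer.
Context {R : realType} {T T' : Type}.
Variables (d : T -> T -> R) (d' : T' -> T' -> R).
Hypotheses (d0 : forall x y, 0 <= d x y) (d'0 : forall x y, 0 <= d' x y).

Lemma le_hdim (A : set T) (A' : set T') :
  (forall t, 0 < t -> null d' t A' -> null d t A) ->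
  (hdim d A <= hdim d' A')%E.
Proof.
move=> nn; apply/lee_addgt0Pr => e e0.
have [->|] := eqVneq (hdim d' A') +oo%E; first by rewrite addye // leey.
move=> A'oo; have fA' : hdim d' A' \is a fin_num by rewrite ge0_fin_numE ?ltey // hdim_ge0.
have f0 : 0 <= fine (hdim d' A') by rewrite fine_ge0 // hdim_ge0.
rewrite -(fineK fA') -EFinD; apply: hdim_le => //; first by rewrite ltr_wpDl.
apply: nn; first by rewrite ltr_wpDl.
by apply: null_hdim => //; rewrite -{1}(fineK fA') lte_fin ltrDl.
Qed.

Lemma hmeasure_gt0_lipschitz (A : set T) (A' : set T') (rho : T -> T' -> Prop) (L t : R) :
  0 <= t -> 0 < L ->
  (forall y, A' y -> exists2 x, A x & rho x y) ->
  (forall x y x' y', rho x y -> rho x' y' -> d' y y' <= L * d x x') ->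
  (0 < hmeasure d' t A')%E -> (0 < hmeasure d t A)%E.
Proof.
move=> t0 L0 AA' lip /hmeasure_gt0 A'p; apply/hmeasure_gt0 => A0; apply: A'p.
have [t00|t00] := eqVneq t 0.
  rewrite t00 in A0 *; move/hmeasure0_eq0P : A0 => A0.
  apply/hmeasure0_eq0P/seteqP; split => // y /AA'[x].
  by rewrite A0.
have t_gt0 : 0 < t by rewrite lt_neqAle eq_sym t00.
apply/(hmeasure_eq0P d'0) => //; apply: (null_lipschitz t_gt0 L0 AA' lip).
exact/(hmeasure_eq0P d0).
Qed.

End HausdorffTransfer.

Lemma hsup_ge0 {R : realType} {T : Type} (d : T -> T -> R) t Z f : (0 <= hsup d t Z f)%E.
Proof. by apply: ereal_sup_ubound; left. Qed.

Lemma hsup_nincr {R : realType} {T : Type} (d : T -> T -> R) t u Z f :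
  (forall x y, 0 <= d x y) -> 0 < t -> t <= u -> (hsup d u Z f <= hsup d t Z f)%E.
Proof.
move=> d0 t0 tu; apply: ge_ereal_sup => _ [->|[q [q0 qp] <-]]; first exact: hsup_ge0.
apply: ereal_sup_ubound; right; exists q => //; split => //.
apply/hmeasure_gt0 => /(hmeasure_eq0P d0 _ t0) n0.
move/hmeasure_gt0 : qp; apply; apply/hmeasure_eq0P => //.
  exact: lt_le_trans tu.
exact: null_le tu n0.
Qed.

Section EssSup.
Context {R : realType} {T T' : Type}.
Variables (d : T -> T -> R) (d' : T' -> T' -> R).
Hypotheses (d0 : forall x y, 0 <= d x y) (d'0 : forall x y, 0 <= d' x y).
Variables (Z : set T) (Z' : set T') (f : T -> \bar R) (f' : T' -> \bar R).
Variables (rho : T -> T' -> Prop) (L : R).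
Hypotheses (L0 : 0 < L).
Hypothesis ZZ' : forall z, Z z -> exists2 z', Z' z' & rho z z'.
Hypothesis Z'Z : forall z', Z' z' -> exists2 z, Z z & rho z z'.
Hypothesis lip : forall x y x' y', rho x y -> rho x' y' -> d' y y' <= L * d x x'.
Hypothesis lip' : forall x y x' y', rho x y -> rho x' y' -> d x x' <= L * d' y y'.
Hypothesis ff' : forall x y, rho x y -> (f x <= f' y)%E.

Lemma le_hsup t : 0 <= t -> (hsup d t Z f <= hsup d' t Z' f')%E.
Proof.
move=> t0; apply: ge_ereal_sup => _ [->|[q [q0 qp] <-]]; first exact: hsup_ge0.
apply: ereal_sup_ubound; right; exists q => //; split => //.
apply: (hmeasure_gt0_lipschitz d'0 d0 (rho := fun y x => rho x y) t0 L0 _ _ qp).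
  move=> x [Zx qx]; have [y Z'y xy] := ZZ' Zx; exists y => //; split => //.
  exact: lt_le_trans (ff' xy).
by move=> y x y' x'; exact: lip'.
Qed.

(** When the measure vanishes, the dimension a is positive, as Z is nonempty, so
    near 0 the limits only involve positive exponents a - e. Both limits exist
    because [hsup] is monotone in the exponent. *)
Lemma le_hess_sup a : 0 <= a -> Z !=set0 ->
  (hess_sup d a Z f <= hess_sup d' a Z' f')%E.
Proof.
move=> a0 Z0; rewrite /hess_sup.
have -> : (0 < hmeasure d' a Z')%E = (0 < hmeasure d a Z)%E.
  apply/idP/idP.
    exact: (hmeasure_gt0_lipschitz d0 d'0 a0 L0 Z'Z lip).
  apply: (hmeasure_gt0_lipschitz d'0 d0 (rho := fun y x => rho x y) a0 L0) => //.
  by move=> y x y' x'; exact: lip'.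
case: ifPn => [_|Zp]; first exact: le_hsup.
have {}a0 : 0 < a.
  rewrite lt_neqAle a0 andbT eq_sym; apply: contraNneq Zp => ->.
  apply/hmeasure_gt0 => /hmeasure0_eq0P ZE; move: Z0; rewrite ZE.
  by case.
have cv (S : Type) (dS : S -> S -> R) (dS0 : forall x y, 0 <= dS x y) Y h :
    cvg (hsup dS (a - e) Y h @[e --> (0:R)^'+]).
  apply: nondecreasing_at_right_is_cvge; near=> x => e e'.
  rewrite !in_itv /= => /andP[e0 ex] /andP[e'0 e'x] ee'.
  apply: hsup_nincr => //; last by rewrite lerB.
  rewrite subr_gt0; apply: lt_trans e'x _; near: x.
  exact: nbhs_right_lt.
apply: lee_lim; [exact: cv|exact: cv|].
near=> e; apply: le_hsup; rewrite subr_ge0 ltW //; near: e.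
Unshelve. all: by end_near. Qed.

End EssSup.

Section Incidence.
Context {R : realType} (d k : nat) (E : set 'rV[R]_d).

Lemma spanned_planes_Gr W : spanned_planes k E W -> affine_Gr d k W.
Proof. by case=> x [_ xi] <-; exact: affine_span_Gr. Qed.

Let X : set 'rV[R]_(d * d + d) := lsubmx @` incidence k E.

Let XE : X = Gr_coord @` spanned_planes k E.
Proof.
apply/seteqP; split.
  move=> _ [_ [x xE <-] <-]; rewrite row_mxKl; exists (affine_span x) => //.
  by exists x.
move=> _ [_ [x xE <-] <-]; exists (row_mx (Gr_coord (affine_span x)) x).
  by exists x.
by rewrite row_mxKl.
Qed.

Lemma hdim_Gr_coord : hdim eucl_dist X = hdim Gr_dist (spanned_planes k E).
Proof.
pose rho W x := spanned_planes k E W /\ x = Gr_coord W.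
pose L : R := (d * d + d).+1%:R.
have L0 : 0 < L by [].
have Lle : (d * d + d)%:R <= L by rewrite ler_nat.
apply/eqP; rewrite eq_le; apply/andP; split.
  apply: (le_hdim (@eucl_dist_ge0 _ _) (@Gr_dist_ge0 _ _)) => t t0.
  apply: (null_lipschitz (rho := rho) t0 L0).
    by move=> x; rewrite XE => -[W PW <-]; exists W.
  move=> W _ V _ [PW ->] [PV ->]; apply: le_trans (Gr_coord_le _ _ _) _.
  - exact: (Gr_dist_ge0 W V).
  - exact: Gr_dist_dirproj.
  - exact: Gr_dist_offset.
  - by rewrite ler_wpM2r ?Gr_dist_ge0.
apply: (le_hdim (@Gr_dist_ge0 _ _) (@eucl_dist_ge0 _ _)) => t t0.
apply: (null_lipschitz (rho := fun x W => rho W x) t0 L0).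
  by move=> W PW; exists (Gr_coord W) => //; rewrite XE; exists W.
move=> _ W _ V [PW ->] [PV ->]; apply: le_trans (Gr_dist_le _ _ _) _.
- exact: (eucl_dist_ge0 (Gr_coord W) (Gr_coord V)).
- exact: Gr_coord_dirproj.
- exact: Gr_coord_offset.
- by rewrite ler_wpM2r ?eucl_dist_ge0.
Qed.

Let fiber x := hdim eucl_dist (incidence k E `&` lsubmx @^-1` [set x]).

(** By injectivity of the coordinates, the fibre over W consists of tuples that
   span W, and whose points therefore lie in W. *)
Let fiber_le W : spanned_planes k E W ->
  (fiber (Gr_coord W) <= hdim eucl_dist (tuple_pow k.+1 E `&` tuple_pow k.+1 W))%E.
Proof.
move=> PW; apply: (le_hdim (@eucl_dist_ge0 _ _) (@eucl_dist_ge0 _ _)) => t t0.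
pose n := (d * d + d + k.+1 * d)%N.
apply: (null_lipschitz (rho := fun w x => x = row_mx (Gr_coord W) w) (L := n.+1%:R) t0) => //.
  move=> _ [[x [xE xi] <-]]; rewrite /= row_mxKl => xW.
  have -> : W = affine_span x.
    by apply: (Gr_coord_inj (spanned_planes_Gr PW) (affine_span_Gr xi)).
  exists x => //; split => // i; exists (delta_mx 0 i); last by rewrite rowE.
  rewrite /= (bigD1 i) //= big1 ?addr0 ?mxE ?eqxx // => j ji.
  by rewrite mxE (negPf ji) andbF.
move=> w _ w' _ -> ->; apply: (@le_trans _ _ (n%:R * eucl_dist w w')); last first.
  by rewrite ler_wpM2r ?eucl_dist_ge0 ?ler_nat.
apply: eucl_dist_le => [|c]; first exact: eucl_dist_ge0.
case: (split_ordP c) => i ->; last by rewrite !row_mxEr eucl_dist_coord.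
by rewrite !row_mxEl subrr normr0 eucl_dist_ge0.
Qed.

Lemma hess_sup_incidence a : 0 <= a -> X !=set0 ->
  (hess_sup eucl_dist a X fiber <=
   hess_sup Gr_dist a (spanned_powers k E)
     (fun V => hdim eucl_dist (tuple_pow k.+1 E `&` V)))%E.
Proof.
move=> a0 X0; pose n := (k.+1 * d)%N.
pose rho x V := exists W, [/\ spanned_planes k E W, x = Gr_coord W & V = tuple_pow k.+1 W].
pose L : R := (d * d + d + (n * n + n)).+1%:R.
apply: (le_hess_sup (@eucl_dist_ge0 _ _) (@Gr_dist_ge0 _ _) (rho := rho) (L := L)) => //.
- move=> x; rewrite XE => -[W PW <-]; exists (tuple_pow k.+1 W); first by exists W.
  by exists W.
- move=> _ [W PW <-]; exists (Gr_coord W); first by rewrite XE; exists W.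
  by exists W.
- move=> _ _ _ _ [W [PW -> ->]] [V [PV -> ->]].
  apply: le_trans (Gr_dist_tuple_pow_le _ (spanned_planes_Gr PW) (spanned_planes_Gr PV)) _.
  by rewrite ler_wpM2r ?eucl_dist_ge0 // ler_nat /n; lia.
- move=> _ _ _ _ [W [PW -> ->]] [V [PV -> ->]].
  apply: le_trans (Gr_coord_tuple_pow_le k (spanned_planes_Gr PW) (spanned_planes_Gr PV)) _.
  by rewrite ler_wpM2r ?Gr_dist_ge0 // ler_nat /n; lia.
- by move=> _ _ [W [PW -> ->]]; exact: fiber_le.
Qed.

Lemma hdim_indep_tuples_le :
  (hdim eucl_dist (indep_tuples k E) <= hdim eucl_dist (incidence k E))%E.
Proof.
apply: (le_hdim (@eucl_dist_ge0 _ _) (@eucl_dist_ge0 _ _)) => t t0.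
apply: (null_lipschitz (rho := fun z x => x = rsubmx z) (L := (k.+1 * d).+1%:R) t0) => //.
  move=> x xE; exists (row_mx (Gr_coord (affine_span x)) x); last by rewrite row_mxKr.
  by exists x.
move=> z _ z' _ -> ->; apply: (@le_trans _ _ ((k.+1 * d)%:R * eucl_dist z z')); last first.
  by rewrite ler_wpM2r ?eucl_dist_ge0 // ler_nat.
apply: eucl_dist_le => [|c]; first exact: eucl_dist_ge0.
by rewrite !mxE eucl_dist_coord.
Qed.

Lemma hdim_incidence_ge (s : R) : k%:R < s -> (s%:E < hdim eucl_dist E)%E ->
  (hdim eucl_dist (tuple_pow k.+1 E) <= hdim eucl_dist (incidence k E))%E.
Proof.
move=> ks sE; apply: le_trans hdim_indep_tuples_le.
have s0 : 0 < s by apply: le_lt_trans ks.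
have nE : ~ null eucl_dist s E.
  by move=> /(hdim_le (@eucl_dist_ge0 _ _) s0); rewrite leNgt sE.
apply: (le_hdim (@eucl_dist_ge0 _ _) (@eucl_dist_ge0 _ _)) => t t0.
exact: null_indep_tuples ks t0 nE.
Qed.

Lemma hdim_tuple_pow_ge (s : R) : 0 < s -> (s%:E < hdim eucl_dist E)%E ->
  ((k.+1%:R * s)%:E <= hdim eucl_dist (tuple_pow k.+1 E))%E.
Proof.
move=> s0 sE; apply: hdim_ge; first exact: eucl_dist_ge0.
apply: tuple_pow_not_null => // /(hdim_le (@eucl_dist_ge0 _ _) s0).
by rewrite leNgt sE.
Qed.

End Incidence.

Theorem theorem1p9 (R : realType) (d k : nat) (s : R) (E : set 'rV[R]_d)
    (hk : (1 <= k <= d - 1)%N)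
    (hE : borel d E)
    (hks : k%:R < s)
    (hs : (s%:E < hdim eucl_dist E)%E)
    (hFubini : Fubini_property (incidence k E))
    (hfib : (hess_sup Gr_dist
               (fine (hdim Gr_dist (spanned_planes k E)))
               (spanned_powers k E)
               (fun V => hdim eucl_dist (tuple_pow k.+1 E `&` V))
             <= maxe 0 (hdim eucl_dist (tuple_pow k.+1 E)
                        - (k.+1 * (d - k))%:R%:E))%E) :
  (((k.+1)%:R * Num.min s (d - k)%:R)%:E
     <= hdim Gr_dist (spanned_planes k E))%E.
Proof.
have s0 : 0 < s by apply: le_lt_trans hks.
have [[z Bz] dimS] := hFubini.
have dimE := hdim_incidence_ge hks hs; have dimE' := @hdim_tuple_pow_ge _ _ k _ _ s0 hs.
rewrite dimS hdim_Gr_coord in dimE.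
have b0 : (0 <= hdim Gr_dist (spanned_planes k E))%E by apply: hdim_ge0.
have X0 : (lsubmx @` incidence k E) !=set0 by exists (lsubmx z); exists z.
have ess := le_trans (hess_sup_incidence (fine_ge0 b0) X0) hfib.
have {ess hfib} := le_trans dimE (leeD2l _ ess).
have : hdim eucl_dist (tuple_pow k.+1 E) \is a fin_num.
  by rewrite ge0_fin_numE ?hdim_lty // hdim_ge0.
move: dimE' b0; case: (hdim eucl_dist (tuple_pow k.+1 E)) => [tau| |] //.
case: (hdim Gr_dist (spanned_planes k E)) => [b| |] //; last by move=> *; rewrite leey.
rewrite !lee_fin -EFinB => tau_s b0 _.
rewrite -EFin_max -EFinD !lee_fin => tau_b.
have k0 : 0 <= k.+1%:R :> R by [].
(* With tau = dim E^(k+1), the bound is now tau <= b + max(0, tau - N), and the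
   two cases of the maximum give the two terms of min(s, d - k). *)
have [m|m] := leP 0 (tau - (k.+1 * (d - k))%:R).
  rewrite (max_idPr m) in tau_b.
  apply: (@le_trans _ _ (k.+1 * (d - k))%:R); last by lra.
  by rewrite natrM ler_wpM2l // ge_min lexx orbT.
rewrite (max_idPl (ltW m)) addr0 in tau_b.
by apply: le_trans tau_b; apply: le_trans tau_s; rewrite ler_wpM2l // ge_min lexx.
Qed.
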